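(* Let $z>y\ge1$ be integers and $0\le\alpha<1$ be such that the $(\alpha,z,y)$-Johnson Coverage$^*$ problem is NP-hard. Then for every constant $\varepsilon>0$ there is a constant $\rho>0$ such that, given as input a point-set $\mathcal{P}\subset\{0,1\}^d$ of size $n$ (with $d=O(\log n)$) and a parameter $k$, it is NP-hard to distinguish between the following two cases: - Completeness: there exist $\mathcal{C}'=\{c_1,\dots,c_k\}\subseteq\mathbb{R}^d$ and $\sigma:\mathcal{P}\to\mathcal{C}'$ such that $\sum_{a\in\mathcal{P}}\|a-\sigma(a)\|_2^2\le\rho\, n\log n$. - Soundness: for every $\mathcal{C}'=\{c_1,\dots,c_k\}\subseteq\mathbb{R}^d$ and every $\sigma:\mathcal{P}\to\mathcal{C}'$, $\sum_{a\in\mathcal{P}}\|a-\sigma(a)\|_2^2\ge\left(1+\frac{1-\alpha}{z-y}-\varepsilon\right)\cdot\rho\, n\log n$.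
   Context: $(\alpha,z,y)$-Johnson Coverage problem ($z>y\ge1$): given a universe $U=[n]=\{1,\dots,n\}$, a collection $E\subseteq\binom{[n]}{z}$ of $z$-element subsets, and a parameter $k$, distinguish between: (Completeness) there are $S_1,\dots,S_k\in\binom{[n]}{y}$ such that every $T\in E$ contains some $S_i$; (Soundness) for all $S_1,\dots,S_k\in\binom{[n]}{y}$, the number of $T\in E$ containing at least one $S_i$ is at most $\alpha|E|$. The $(\alpha,z,y)$-Johnson Coverage$^*$ problem is its special case restricted to instances satisfying $|E|=\omega(k\cdot|U|^{z-y-1})$. *)

(* Defs.v *)
From mathcomp Require Import all_boot all_order all_algebra.
From mathcomp Require Import all_classical all_reals all_analysis.

Set Implicit Arguments.
Unset Strict Implicit.
Unset Printing Implicit Defensive.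

Import Order.TTheory GRing.Theory Num.Theory.

Local Open Scope ring_scope.

(** * Polynomial time *)

(* Structured programs over finitely many stacks of bits (the registers a
   program mentions).  Every elementary step costs 1 and reads, pushes or pops
   a single bit, and two stacks are one Turing tape, so running times agree
   with those of multitape Turing machines up to a constant factor. *)
Inductive prog : Type :=
| Skip
| Push of nat & bool
| Pop of nat
| Then of prog & prog
| Case of nat & prog & prog & prog (* top of the stack: empty, true, false *)
| While of nat & prog.             (* loop as long as the stack is nonempty *)

Definition store := nat -> bitseq.

(* [exec c s t s']: from [s], program [c] halts in [s'] after [t] steps. *)
Inductive exec : prog -> store -> nat -> store -> Prop :=
| ExecSkip s : exec Skip s 1 s
| ExecPush s r b : exec (Push r b) s 1 [eta s with r |-> b :: s r]
| ExecPop s r : exec (Pop r) s 1 [eta s with r |-> behead (s r)]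
| ExecThen c1 c2 s s1 s2 t1 t2 :
    exec c1 s t1 s1 -> exec c2 s1 t2 s2 -> exec (Then c1 c2) s (t1 + t2)%N s2
| ExecCase r c0 c1 c2 s s' t :
    exec (if s r is b :: _ then if b then c1 else c2 else c0) s t s' ->
    exec (Case r c0 c1 c2) s t.+1 s'
| ExecWhileStop r c s : s r = [::] -> exec (While r c) s 1 s
| ExecWhileStep r c s s1 s2 t1 t2 :
    s r <> [::] -> exec c s t1 s1 -> exec (While r c) s1 t2 s2 ->
    exec (While r c) s (t1 + t2).+1 s2.

(* Register 0 holds the input and the output, all other registers start
   empty. *)
Definition input_store (w : bitseq) : store := [eta (fun=> [::]) with 0%N |-> w].

Definition poly_time (f : bitseq -> bitseq) : Prop :=
  exists (c : prog) (p : {poly nat}), forall w : bitseq,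
    exists (t : nat) (s : store),
      [/\ exec c (input_store w) t s, s 0%N = f w & (t <= p.[size w])%N].

(** * NP and NP-hardness *)

(* Self-delimiting encoding: every bit is preceded by [true], and [false]
   marks the end. *)
Definition delimit (w : bitseq) : bitseq :=
  flatten [seq [:: true; b] | b <- w] ++ [:: false].

Definition in_NP (L : bitseq -> Prop) : Prop :=
  exists (V : bitseq -> bitseq) (p : {poly nat}), poly_time V /\
    forall x, L x <->
      exists c, (size c <= p.[size x])%N /\ V (delimit x ++ c) = [:: true].

Record promise_problem := PromiseProblem {
  yes_instance : bitseq -> Prop;
  no_instance : bitseq -> Prop
}.

(* Polynomial-time many-one reductions from every language in NP. *)
Definition NP_hard (Pi : promise_problem) : Prop :=
  forall L, in_NP L -> exists f, poly_time f /\
    forall x, (L x -> yes_instance Pi (f x)) /\ (~ L x -> no_instance Pi (f x)).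

(* A parameter [k], in unary, followed by a list of 0/1 vectors. *)
Definition encode (k : nat) (rows : seq bitseq) : bitseq :=
  delimit (nseq k true) ++ flatten [seq delimit r | r <- rows].

(** * Johnson Coverage *)

Definition char_vector (n : nat) (T : {set 'I_n}) : bitseq :=
  [seq i \in T | i <- enum 'I_n].

(* [w] presents (n, E, k) by an incidence matrix, the members of [E] being
   listed in any order. *)
Definition encodes_hypergraph (n : nat) (E : {set {set 'I_n}}) (k : nat)
    (w : bitseq) : Prop :=
  exists l : seq {set 'I_n},
    perm_eq l (enum E) /\ w = encode k [seq char_vector T | T <- l].

Definition johnson_instance (z n : nat) (E : {set {set 'I_n}}) (k : nat) :
    Prop :=
  [/\ (0 < k)%N, E != finset.set0 & forall T, T \in E -> #|T| = z].

Definition johnson_complete (y n : nat) (E : {set {set 'I_n}}) (k : nat) :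
    Prop :=
  exists S : 'I_k -> {set 'I_n},
    (forall i, #|S i| = y) /\
    (forall T, T \in E -> exists i, S i \subset T).

Definition johnson_sound (R : realType) (alpha : R) (y n : nat)
    (E : {set {set 'I_n}}) (k : nat) : Prop :=
  forall S : 'I_k -> {set 'I_n}, (forall i, #|S i| = y) ->
    #|[set T in E | [exists i, S i \subset T]]|%:R <= alpha * #|E|%:R.

(* The rate [h] is the function hidden in |E| = omega(k |U|^(z-y-1)). *)
Definition johnson_star_instance (R : realType) (h : nat -> R) (z y n : nat)
    (E : {set {set 'I_n}}) (k : nat) : Prop :=
  johnson_instance z E k /\
  h n * (k%:R * n%:R ^+ (z - y - 1)) <= #|E|%:R.

Definition johnson_coverage_star (R : realType) (h : nat -> R) (alpha : R)
    (z y : nat) : promise_problem :=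
  {| yes_instance := fun w => exists n (E : {set {set 'I_n}}) k,
       [/\ encodes_hypergraph E k w, johnson_star_instance h z y E k
         & johnson_complete y E k];
     no_instance := fun w => exists n (E : {set {set 'I_n}}) k,
       [/\ encodes_hypergraph E k w, johnson_star_instance h z y E k
         & johnson_sound alpha y E k] |}.

Definition johnson_coverage_star_NP_hard (R : realType) (alpha : R)
    (z y : nat) : Prop :=
  exists h : nat -> R,
    (h m @[m --> \oo] --> +oo)%classic /\
    NP_hard (johnson_coverage_star h alpha z y).

(** * k-means *)

Definition encodes_points (d : nat) (P : {set d.-tuple bool}) (k : nat)
    (w : bitseq) : Prop :=
  exists l : seq (d.-tuple bool),
    perm_eq l (enum P) /\ w = encode k [seq tval a | a <- l].

Definition point_vector (R : realType) (d : nat) (a : d.-tuple bool) :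
    'rV[R]_d :=
  \row_j (tnth a j)%:R.

(* The library norm on row vectors is the sup norm, hence this definition. *)
Definition sq_l2norm (R : realType) (d : nat) (x : 'rV[R]_d) : R :=
  \sum_j x 0 j ^+ 2.

Definition kmeans_cost (R : realType) (d k : nat) (P : {set d.-tuple bool})
    (c : 'I_k -> 'rV[R]_d) (sigma : d.-tuple bool -> 'I_k) : R :=
  \sum_(a in P) sq_l2norm (point_vector R a - c (sigma a)).

(* At least two points: otherwise log n <= 0, and an instance could satisfy
   completeness and soundness at once. *)
Definition kmeans_instance (R : realType) (D : R) (d : nat)
    (P : {set d.-tuple bool}) (k : nat) : Prop :=
  [/\ (0 < k)%N, (1 < #|P|)%N & d%:R <= D * ln #|P|%:R].

Definition kmeans_complete (R : realType) (rho : R) (d : nat)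
    (P : {set d.-tuple bool}) (k : nat) : Prop :=
  exists (c : 'I_k -> 'rV[R]_d) (sigma : d.-tuple bool -> 'I_k),
    kmeans_cost P c sigma <= rho * (#|P|%:R * ln #|P|%:R).

Definition kmeans_sound (R : realType) (gap rho : R) (d : nat)
    (P : {set d.-tuple bool}) (k : nat) : Prop :=
  forall (c : 'I_k -> 'rV[R]_d) (sigma : d.-tuple bool -> 'I_k),
    gap * (rho * (#|P|%:R * ln #|P|%:R)) <= kmeans_cost P c sigma.

Definition gap_kmeans (R : realType) (D rho gap : R) : promise_problem :=
  {| yes_instance := fun w => exists d (P : {set d.-tuple bool}) k,
       [/\ encodes_points P k w, kmeans_instance D P k
         & kmeans_complete rho P k];
     no_instance := fun w => exists d (P : {set d.-tuple bool}) k,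
       [/\ encodes_points P k w, kmeans_instance D P k
         & kmeans_sound gap rho P k] |}.

(* Main.v *)
(* A hyperedge T becomes the indicator vector of the union of sets B_v, v in T,
   where the B_v have the same size l and pairwise intersections of size at most
   l / Q.  Squared distances are then l times those of the Johnson graph,
     up to a
   factor 1 - 2z/Q, and the union over a y-set S contained in T is at distance
   (z - y) l.  The B_v are one-hot encodings of words of length
   l = C floor(log2 |E|) over an alphabet of size q = 8^Q, chosen greedily as in
   the Gilbert-Varshamov bound, so that the dimension q l is O(log |E|).

   For soundness, the cost of a cluster is half its average sum of squared
   distances, hence governed by the degrees of the vertices in the cluster.
     Only
   boundedly many vertices have a non-negligible degree; the edges containing
   more than y of them number O(n^(z-y-1)), which is negligible because of
   |E| = omega(k n^(z-y-1)).  For any other edge a union bound shows that y - 1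
   plus the largest fraction of the cluster covered by a single y-set dominates
   the average degree sum.

   Polynomial time is obtained from closure properties (composition, pairs,
   conditionals, folds with polynomially bounded accumulators) of the functions
   computed by programs that leave all other stacks empty. *)
Require Import Defs.
From mathcomp Require Import all_boot all_order all_algebra.
From mathcomp Require Import all_classical all_reals all_analysis.
From mathcomp Require Import zify ring lra.

Set Implicit Arguments.
Unset Strict Implicit.
Unset Printing Implicit Defensive.

Import Order.TTheory GRing.Theory Num.Theory.

(** * Programs on finitely many stacks *)

Local Open Scope nat_scope.

(** The point set has |E| members, so the logarithm in the cost is log |E|. Each edge pays at most
    (z - y) l in the complete case with l = C floor(log2 |E|), whence rho = (z - y) C / ln 2. In the
    sound case the clusters together pay at least (z - y + 1 - alpha) l per edge up to small losses,
    and the ratio of the two is the gap. Two demands meet in the code. All q^l one-hot words must be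
    listed in time polynomial in the input, which allows brute force only for l = O(log |E|); and
    the greedy choice must survive one step for each of up to z |E| non-isolated vertices, which
    leads to C = z + 2. The edges with too many vertices of large degree are an error paid once per
    cluster; this is why the rate has to beat k n^(z-y-1). The rate is only asymptotic in n, so
    negative inputs over small universes escape the analysis. They are looked up in a finite table,
    which is consistent because no word encodes both a positive and a negative instance. *)

Definition runs (c : prog) (s s' : store) (T : nat) : Prop :=
  exists2 t, exec c s t s' & t <= T.

Definition upd (s : store) (r : nat) (x : bitseq) : store :=
  [eta s with r |-> x].

Definition stacks (l : seq bitseq) : store := nth [::] l.

Lemma updE s r x r' : upd s r x r' = if r' == r then x else s r'.
Proof. by []. Qed.

Lemma upd_stacks l r x : upd (stacks l) r x = stacks (set_nth [::] l r x).
Proof. by apply: funext => r'; rewrite updE /stacks nth_set_nth. Qed.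

Lemma input_storeE w : input_store w = stacks [:: w].
Proof. by apply: funext => -[|[|r]]. Qed.

Lemma runs_weak c s s' T T' : runs c s s' T -> T <= T' -> runs c s s' T'.
Proof. by case=> t ct tT TT'; exists t => //; apply: leq_trans TT'. Qed.

Lemma runs_skip s : runs Skip s s 1.
Proof. by exists 1 => //; constructor. Qed.

Lemma runs_push s r b : runs (Push r b) s (upd s r (b :: s r)) 1.
Proof. by exists 1 => //; constructor. Qed.

Lemma runs_pop s r : runs (Pop r) s (upd s r (behead (s r))) 1.
Proof. by exists 1 => //; constructor. Qed.

Lemma runs_then c1 c2 s s1 s2 T1 T2 :
  runs c1 s s1 T1 -> runs c2 s1 s2 T2 -> runs (Then c1 c2) s s2 (T1 + T2).
Proof.
case=> t1 e1 l1 [t2 e2 l2]; exists (t1 + t2); first exact: ExecThen e1 e2.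
exact: leq_add.
Qed.

Lemma runs_case r c0 c1 c2 s s' T :
  runs (if s r is b :: _ then if b then c1 else c2 else c0) s s' T ->
  runs (Case r c0 c1 c2) s s' T.+1.
Proof. by case=> t e l; exists t.+1 => //; apply: ExecCase. Qed.

Definition forbits r (c : bool -> prog) : prog :=
  While r (Case r Skip (Then (Pop r) (c true)) (Then (Pop r) (c false))).

(** A loop invariant with state: in [S x v] the word [x] is still to be read and [v] is what has
    been computed. The body starts after the bit is popped, so it leads from the shortened store to
    the next [S]. *)
Lemma runs_forbits (V : Type) (S : bitseq -> V -> store) (next : V -> bool -> V)
    r c T :
  (forall x v, S x v r = x) ->
  (forall b x v, runs (c b) (upd (S (b :: x) v) r x) (S x (next v b)) T) ->
  forall x v, runs (forbits r c) (S x v) (S [::] (foldl next v x))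
    ((T + 3) * (size x).+1).
Proof.
move=> Sr cS; elim=> [|b x IH] v /=.
  by exists 1; [apply: ExecWhileStop; rewrite Sr | lia].
have [t' e' l'] := IH (next v b).
have [t [e l]] : exists t, exec (c b) (upd (S (b :: x) v) r x) t
    (S x (next v b)) /\ t <= T by have [t e l] := cS b x v; exists t.
exists (((1 + t).+1) + t').+1; last by nia.
apply: ExecWhileStep e'; first by rewrite Sr.
apply: ExecCase; rewrite Sr.
have -> : (if b then Then (Pop r) (c true) else Then (Pop r) (c false))
  = Then (Pop r) (c b) by case: b {e cS}.
apply: ExecThen e.
by have := ExecPop (S (b :: x) v) r; rewrite Sr.
Qed.

(* The content is reversed on the way. *)
Definition mv r r' : prog := forbits r (fun b => Push r' b).

Lemma foldl_cons (T : Type) (v x : seq T) :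
  foldl (fun v b => b :: v) v x = catrev x v.
Proof. by elim: x v => //= a x IH v; rewrite IH. Qed.

Lemma runs_mv r r' l : r != r' ->
  runs (mv r r') (stacks l)
    (stacks (set_nth [::] (set_nth [::] l r [::]) r'
          (catrev (nth [::] l r) (nth [::] l r'))))
    (4 * (size (nth [::] l r)).+1).
Proof.
move=> rr'; rewrite -!upd_stacks.
pose S x v := upd (upd (stacks l) r x) r' v.
have E : stacks l = S (stacks l r) (stacks l r').
  apply: funext => k; rewrite /S !updE.
  by case: eqVneq => [->//|_]; case: eqVneq => [->|].
rewrite {1}E -foldl_cons.
apply: (@runs_forbits _ S (fun v b => b :: v) _ (fun b => Push r' b) 1 _ _
  (stacks l r) (stacks l r')).
  by move=> x v; rewrite /S !updE (negbTE rr') eqxx.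
move=> b x v; have := runs_push (upd (S (b :: x) v) r x) r' b.
congr runs; apply: funext => k; rewrite /S !updE eqxx [r' == r]eq_sym (negbTE
  rr').
by case: (eqVneq k r') => // _; case: eqVneq.
Qed.

(** Pushing reverses a word, so this is meant for a word that has been reversed before. *)
Definition mv_delimit r r' : prog :=
  Then (Push r' false) (forbits r (fun b => Then (Push r' b) (Push r' true))).

Lemma foldl_delimit v x :
  foldl (fun v b => true :: b :: v) v x =
  flatten [seq [:: true; b] | b <- rev x] ++ v.
Proof.
elim: x v => //= a x IH v.
by rewrite IH rev_cons map_rcons -cats1 flatten_cat -catA.
Qed.

Lemma runs_mv_delimit r r' l : r != r' ->
  runs (mv_delimit r r') (stacks l)
    (stacks (set_nth [::] (set_nth [::] l r [::]) r'
          (delimit (rev (nth [::] l r)) ++ nth [::] l r')))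
    (6 * (size (nth [::] l r)).+1).
Proof.
move=> rr'; rewrite -!upd_stacks.
pose S x v := upd (upd (stacks l) r x) r' v.
apply: (@runs_weak _ _ _ (1 + 5 * (size (nth [::] l r)).+1)); last lia.
apply: runs_then; first exact: runs_push.
have -> : upd (stacks l) r' (false :: stacks l r') =
  S (stacks l r) (false :: stacks l r').
  apply: funext => k; rewrite /S !updE.
  by case: (eqVneq k r') => // _; case: (eqVneq k r) => [->|].
rewrite /delimit -catA -foldl_delimit.
apply: (@runs_forbits _ S (fun v b => true :: b :: v) _
  (fun b => Then (Push r' b) (Push r' true)) 2 _ _
  (stacks l r) (false :: stacks l r')).
  by move=> x v; rewrite /S !updE (negbTE rr') eqxx.
move=> b x v.
have := runs_then (runs_push (upd (S (b :: x) v) r x) r' b)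
  (runs_push _ r' true).
congr runs; apply: funext => k; rewrite /S !updE !eqxx [r' == r]eq_sym (negbTE
  rr').
by case: (eqVneq k r') => // _; case: eqVneq.
Qed.

Fixpoint undelimit (w : bitseq) : bitseq * bitseq :=
  match w with
  | true :: b :: w' => let u := undelimit w' in (b :: u.1, u.2)
  | false :: w' => ([::], w')
  | _ => ([::], [::])
  end.

Lemma undelimitK x y : undelimit (delimit x ++ y) = (x, y).
Proof. by rewrite /delimit -catA; elim: x => //= b x ->. Qed.

(* Register 2 is the flag that keeps the loop running. *)
Definition split_delimit : prog :=
  Then (Push 2 true)
    (While 2 (Case 0 (Pop 2)
       (Then (Pop 0) (Case 0 (Pop 2) (Then (Pop 0) (Push 1 true))
          (Then (Pop 0) (Push 1 false))))
       (Then (Pop 0) (Pop 2)))).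

Lemma runs_step r c s s1 s2 T1 T2 : s r <> [::] -> runs c s s1 T1 ->
  runs (While r c) s1 s2 T2 -> runs (While r c) s s2 (T1 + T2).+1.
Proof.
move=> sr [t1 e1 l1] [t2 e2 l2]; exists (t1 + t2).+1; last by lia.
exact: ExecWhileStep e1 e2.
Qed.

Lemma runs_stop r c s : s r = [::] -> runs (While r c) s s 1.
Proof. by move=> sr; exists 1 => //; apply: ExecWhileStop. Qed.

Lemma stacks_push l r b : runs (Push r b) (stacks l)
  (stacks (set_nth [::] l r (b :: nth [::] l r))) 1.
Proof. by have := runs_push (stacks l) r b; rewrite upd_stacks. Qed.

Lemma stacks_pop l r : runs (Pop r) (stacks l)
  (stacks (set_nth [::] l r (behead (nth [::] l r)))) 1.
Proof. by have := runs_pop (stacks l) r; rewrite upd_stacks. Qed.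

Lemma runs_split_delimit w v l : runs split_delimit (stacks [:: w, v, [::] & l])
  (stacks [:: (undelimit w).2, catrev (undelimit w).1 v, [::] & l])
  (7 * (size w).+1).
Proof.
apply: (@runs_weak _ _ _ (1 + (5 + 7 * size w))); last lia.
apply: runs_then; first exact: stacks_push.
rewrite /=; have [n] := ubnP (size w); elim: n w v => // n IH.
have done_step u v : runs (Then (Pop 0) (Pop 2)) (stacks [:: u, v, [:: true] &
  l])
    (stacks [:: behead u, v, [::] & l]) 2.
  by apply: (@runs_then _ _ _ _ _ 1 1); [exact: stacks_pop | exact: stacks_pop].
case=> [|[] w] v /= wn.
- apply: (@runs_weak _ _ _ (2 + 1).+1); last by lia.
  apply: (@runs_step _ _ _ (stacks [:: [::], v, [::] & l])) => //;
    last exact: runs_stop.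
  by apply: runs_case => /=; exact: stacks_pop.
- case: w wn => [|b w] /= wn.
    apply: (@runs_weak _ _ _ (4 + 1).+1); last by lia.
    apply: (@runs_step _ _ _ (stacks [:: [::], v, [::] & l])) => //;
      last exact: runs_stop.
    apply: runs_case => /=; apply: (@runs_then _ _ _ _ _ 1 2);
      first exact: stacks_pop.
    by apply: runs_case => /=; exact: stacks_pop.
  apply: (@runs_weak _ _ _ (5 + (5 + 7 * size w)).+1); last by lia.
  apply: (@runs_step _ _ _ (stacks [:: w, b :: v, [:: true] & l])) => //;
    last by apply: IH; lia.
  apply: runs_case => /=; apply: (@runs_then _ _ _ _ _ 1 3);
      first exact: stacks_pop.
  apply: runs_case => /=.
  by case: b; apply: (@runs_then _ _ _ _ _ 1 1); 
    [exact: stacks_pop | exact: stacks_push | exact: stacks_pop | exact: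
      stacks_push].
- apply: (@runs_weak _ _ _ (3 + 1).+1); last by lia.
  apply: (@runs_step _ _ _ (stacks [:: w, v, [::] & l])) => //;
    last exact: runs_stop.
  by apply: runs_case => /=; exact: done_step.
Qed.

(** * Running a program above saved registers *)

Fixpoint shift_prog (k : nat) (c : prog) : prog :=
  match c with
  | Skip => Skip
  | Push r b => Push (k + r) b
  | Pop r => Pop (k + r)
  | Then c1 c2 => Then (shift_prog k c1) (shift_prog k c2)
  | Case r c0 c1 c2 => Case (k + r) (shift_prog k c0) (shift_prog k c1)
    (shift_prog k c2)
  | While r c => While (k + r) (shift_prog k c)
  end.

Definition frame (pre : seq bitseq) (s : store) : store :=
  fun r => if r < size pre then nth [::] pre r else s (r - size pre).

Lemma frame_stacks pre l : frame pre (stacks l) = stacks (pre ++ l).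
Proof. by apply: funext => r; rewrite /frame /stacks nth_cat. Qed.

Lemma frameD pre s r : frame pre s (size pre + r) = s r.
Proof. by rewrite /frame ltnNge leq_addr /= addKn. Qed.

Lemma frame_upd pre s r x :
  frame pre [eta s with r |-> x] = [eta frame pre s with size pre + r |-> x].
Proof.
apply: funext => k; rewrite /frame /=.
have [kp|pk] := ltnP k (size pre).
  by case: eqVneq => // E; rewrite E in kp; lia.
by have -> : (k == size pre + r) = (k - size pre == r) by lia.
Qed.

Lemma exec_shift pre c s t s' : exec c s t s' ->
  exec (shift_prog (size pre) c) (frame pre s) t (frame pre s').
Proof.
elim=> {c s t s'} /=.
- by move=> s; constructor.
- move=> s r b; rewrite frame_upd -[in b :: _](frameD pre); exact: ExecPush.
- move=> s r; rewrite frame_upd -[in behead _](frameD pre); exact: ExecPop.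
- by move=> c1 c2 s s1 s2 t1 t2 _ e1 _ e2; apply: ExecThen e1 e2.
- move=> r c0 c1 c2 s s' t _ e; apply: ExecCase; rewrite frameD.
  by case: (s r) e => [|[] l].
- by move=> r c s sr; apply: ExecWhileStop; rewrite frameD.
- move=> r c s s1 s2 t1 t2 sr _ e1 _ e2; apply: ExecWhileStep e1 e2.
  by rewrite frameD.
Qed.

Lemma runs_shift pre c l l' T : runs c (stacks l) (stacks l') T ->
  runs (shift_prog (size pre) c) (stacks (pre ++ l)) (stacks (pre ++ l')) T.
Proof.
by case=> t e h; exists t => //; rewrite -!frame_stacks; apply: exec_shift.
Qed.

Lemma stacks_nil l : stacks (rcons l [::]) = stacks l.
Proof.
apply: funext => r; rewrite /stacks nth_rcons; case: ltnP => // h.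
by rewrite nth_default //; case: ifP.
Qed.

(** A step pushes at most one bit. This turns time bounds into size bounds for results and for
    leftover contents. *)
Lemma exec_size c s t s' : exec c s t s' ->
  forall r, size (s' r) <= size (s r) + t.
Proof.
elim=> {c s t s'} /=.
- by move=> s r; rewrite leq_addr.
- by move=> s r b k; case: eqVneq => [->|_] /=; lia.
- by move=> s r k; case: eqVneq => [->|_] /=; rewrite ?size_behead; lia.
- by move=> c1 c2 s s1 s2 t1 t2 _ e1 _ e2 r; have := e1 r; have := e2 r; lia.
- by move=> r c0 c1 c2 s s' t _ e k; have := e k; lia.
- by move=> r c s _ k; lia.
- by move=> r c s s1 s2 t1 t2 _ _ e1 _ e2 k; have := e1 k; have := e2 k; lia.
Qed.

Lemma runs_eq c s s1 s2 T : runs c s s1 T -> s1 = s2 -> runs c s s2 T.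
Proof. by move=> + <-. Qed.

Lemma stacks_nil3 x : stacks [:: x; [::]; [::]] = stacks [:: x].
Proof. by rewrite (stacks_nil [:: x; [::]]) (stacks_nil [:: x]). Qed.

Lemma stacks_nil4 x : stacks [:: x; [::]; [::]; [::]] = stacks [:: x].
Proof. by rewrite (stacks_nil [:: x; [::]; [::]]) stacks_nil3. Qed.

Definition clear r : prog := forbits r (fun=> Skip).

Lemma runs_clear r l :
  runs (clear r) (stacks l) (stacks (set_nth [::] l r [::])) (4 * (size (nth
    [::] l r)).+1).
Proof.
rewrite -!upd_stacks; pose S x (v : unit) := upd (stacks l) r x.
have E : stacks l = S (stacks l r) tt.
  by apply: funext => k; rewrite /S updE; case: eqVneq => [->|].
rewrite {1}E.
apply: (@runs_forbits _ S (fun v b => v) _ (fun=> Skip) 1 _ _ (stacks l r) tt).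
  by move=> x v; rewrite /S updE eqxx.
move=> b x v; have := runs_skip (S x v); congr runs; apply: funext => k.
by rewrite /S !updE; case: eqVneq.
Qed.

(** * Polynomial-time functions between encodable types *)

(** Only the first component of a pair and the members of a list are delimited. So a nonempty list
    has the encoding of the pair of its head and tail, and [(nseq k true, rows)] is encoded as
    [encode k rows]. The priorities make [seq bool] a raw word instead of a list of encoded
    booleans. *)
Class encodable (A : Type) := enc : A -> bitseq.
#[export] Instance enc_bits : encodable (seq bool) | 0 := id.
#[export] Instance enc_bool : encodable bool | 0 := fun b => [:: b].
#[export] Instance enc_pair A B {eA : encodable A} {eB : encodable B} :
  encodable (A * B) | 1 := fun p => delimit (enc p.1) ++ enc p.2.
#[export] Instance enc_seq A {eA : encodable A} : encodable (seq A) | 2 :=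
  fun l => flatten [seq delimit (enc a) | a <- l].

Lemma size_delimit w : size (delimit w) = (size w).*2.+1.
Proof.
rewrite /delimit size_cat addn1; congr _.+1.
by elim: w => //= b w ->; rewrite doubleS.
Qed.

Lemma size_enc_pair A B {eA : encodable A} {eB : encodable B} (p : A * B) :
  size (enc p) = (size (enc p.1)).*2.+1 + size (enc p.2).
Proof. by rewrite size_cat size_delimit. Qed.

(** The base is at least 2, so a single exponent absorbs constants, sums and products. *)
Definition poly_bounded {E} {eE : encodable E} (f : E -> nat) : Prop :=
  exists K, forall e, f e <= (size (enc e)).+2 ^ K.

Section PolyBound.
Context {E : Type} {eE : encodable E}.
Implicit Types f g : E -> nat.

Lemma poly_bounded_le f g : (forall e, f e <= g e) -> poly_bounded g ->
  poly_bounded f.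
Proof. by move=> fg [K gK]; exists K => e; apply: leq_trans (fg e) (gK e). Qed.

Lemma poly_bounded_const n : poly_bounded (fun _ : E => n).
Proof.
by exists n => e; rewrite ltnW // ltn_expl.
Qed.

Lemma poly_bounded_size : poly_bounded (fun e : E => size (enc e)).
Proof. by exists 1 => e; rewrite expn1; lia. Qed.

Lemma poly_bounded_mul f g : poly_bounded f -> poly_bounded g ->
  poly_bounded (fun e => f e * g e).
Proof. by case=> K fK [L gL]; exists (K + L) => e; rewrite expnD leq_mul. Qed.

Lemma poly_bounded_exp f k : poly_bounded f -> poly_bounded (fun e => f e ^ k).
Proof.
by case=> K fK; exists (K * k) => e; rewrite expnM; case: k => // k;
  rewrite leq_exp2r.
Qed.

Lemma poly_bounded_add f g : poly_bounded f -> poly_bounded g ->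
  poly_bounded (fun e => f e + g e).
Proof.
move=> fp gp; apply: (@poly_bounded_le _ (fun e => (f e).+1 * (g e).+1)).
  by move=> e; lia.
have pS h : poly_bounded h -> poly_bounded (fun e => (h e).+1).
  case=> K hK; exists K.+1 => e; rewrite expnS.
  apply: (@leq_trans (2 * (size (enc e)).+2 ^ K)); last exact: leq_mul.
  have := hK e; have : 0 < (size (enc e)).+2 ^ K.
    by rewrite expn_gt0.
  lia.
by apply: poly_bounded_mul; apply: pS.
Qed.

End PolyBound.

Definition polytime {A B} {eA : encodable A} {eB : encodable B} (f : A -> B) :
  Prop :=
  exists c T, poly_bounded T /\
    forall a, runs c (stacks [:: enc a]) (stacks [:: enc (f a)]) (T a).

(** A program sees only encodings, so it also computes every function with the same input and output
    words. Pairing thus yields [cons] at no cost. *)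
Lemma polytime_enc {A B C D} {eA : encodable A} {eB : encodable B}
    {eC : encodable C} {eD : encodable D} (f : A -> B) (g : C -> D) (i : C ->
      A) :
  polytime f -> (forall c, enc (i c) = enc c) ->
    (forall c, enc (f (i c)) = enc (g c)) ->
  polytime g.
Proof.
case=> c [T [[K TK] fT]] iE fgE; exists c, (T \o i); split.
  by exists K => a /=; rewrite -iE.
by move=> a; have := fT (i a); rewrite iE fgE.
Qed.

Section PolyTime.
Context {A B C : Type} {eA : encodable A} {eB : encodable B} {eC : encodable C}.

Lemma polytime_ext (f g : A -> B) : polytime f -> f =1 g -> polytime g.
Proof. by move=> Pf fg; apply: (polytime_enc (i := id) Pf) => // c;
  congr enc. Qed.

Lemma polytime_size (f : A -> B) : polytime f ->
  poly_bounded (fun a => size (enc (f a))).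
Proof.
case=> c [T [Tp fT]]; apply: (poly_bounded_le _ (poly_bounded_add
  poly_bounded_size Tp)) => a.
have [t /exec_size /(_ 0) /= h tT] := fT a.
by apply: leq_trans h _; rewrite leq_add2l.
Qed.

Lemma poly_bounded_comp (f : A -> B) (g : B -> nat) : polytime f ->
  poly_bounded g -> poly_bounded (fun a => g (f a)).
Proof.
move=> /polytime_size fp [K gK].
apply: (poly_bounded_le (g := fun a => (size (enc (f a)) + 2) ^ K)).
  by move=> a; have := gK (f a); rewrite addn2.
by apply/poly_bounded_exp/poly_bounded_add/poly_bounded_const.
Qed.

End PolyTime.

Ltac bound_tac := repeat first
  [ exact: poly_bounded_const | exact: poly_bounded_size | assumption
  | apply: polytime_size; assumption | apply: poly_bounded_comp; assumption
  | apply: poly_bounded_add | apply: poly_bounded_mul ].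

Section PolyTimeClosure.
Context {A B C : Type} {eA : encodable A} {eB : encodable B} {eC : encodable C}.

Lemma polytime_comp (f : A -> B) (g : B -> C) : polytime f -> polytime g ->
  polytime (fun a => g (f a)).
Proof.
move=> Pf [d [U [Up gU]]]; have := Pf; case=> c [T [Tp fT]].
exists (Then c d), (fun a => T a + U (f a)); split.
  exact: poly_bounded_add (poly_bounded_comp Pf Up).
by move=> a; apply: runs_then (fT a) (gU _).
Qed.

Lemma polytime_id : polytime (fun a : A => a).
Proof.
exists Skip, (fun=> 1); split; first exact: poly_bounded_const.
by move=> a; exact: runs_skip.
Qed.

Lemma polytime_pair (f : A -> B) (g : A -> C) : polytime f -> polytime g ->
  polytime (fun a => (f a, g a)).
Proof.
move=> Pf Pg; have [c [T [Tp fT]]] := Pf; have [d [U [Up gU]]] := Pg.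
(* The input is duplicated into registers 0 and 2. [d] runs above the first copy, then [c] above the
   reversed result of [d]. The second component returns to register 0 first, since the delimited
   first component must end on top of it. *)
exists (Then (mv 0 1) (Then (forbits 1 (fun b => Then (Push 0 b) (Push 2 b)))
  (Then (shift_prog 2 d) (Then (mv 2 1) (Then (mv 0 2) (Then (mv 2 3)
  (Then (shift_prog 3 c) (Then (mv 1 0) (Then (mv 3 1)
  (mv_delimit 1 0)))))))))).
exists (fun a => 40 * (1 + size (enc a) + size (enc (f a)) + size (enc (g a)))
  + T a + U a); split.
  by bound_tac.
move=> a; apply: runs_weak.
  apply: runs_then; first by apply: runs_mv.
  rewrite /=; apply: runs_then.
    pose S x v := stacks [:: v; x; v].
    rewrite -[stacks _]stacks_nil.
    apply: (@runs_forbits _ S (fun v b => b :: v) _ _ 2 _ _ _ [::]).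
      by [].
    move=> b x v; rewrite /S upd_stacks /=.
    by apply: (@runs_then _ _ _ _ _ 1 1);
      [exact: stacks_push|exact: stacks_push].
  rewrite foldl_cons !catrevE !cats0 revK; apply: runs_then.
    exact: (runs_shift [:: enc a; [::]] (gU a)).
  rewrite /=; apply: runs_then; first by apply: runs_mv.
  rewrite /=; apply: runs_then; first by apply: runs_mv.
  rewrite /=; apply: runs_then; first by apply: runs_mv.
  rewrite /= !catrevE !cats0 revK; apply: runs_then.
    exact: (runs_shift [:: [::]; rev (enc (g a)); [::]] (fT a)).
  rewrite /=; apply: runs_then; first by apply: runs_mv.
  rewrite /=; apply: runs_then; first by apply: runs_mv.
  rewrite /= !catrevE !cats0 revK.
  apply: runs_eq; first by apply: runs_mv_delimit.
  by rewrite /= revK stacks_nil4.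
rewrite /= !size_rev; lia.
Qed.

Lemma polytime_fst : polytime (fun p : A * B => p.1).
Proof.
exists (Then split_delimit (Then (clear 0) (mv 1 0))).
exists (fun p => 20 * (1 + size (enc p))); split.
  by bound_tac.
move=> [a b]; apply: runs_weak.
  rewrite -[stacks [:: enc _]]stacks_nil3.
  apply: runs_then; first exact: runs_split_delimit.
  rewrite undelimitK /=; apply: runs_then; first exact: runs_clear.
  apply: runs_eq; first by apply: runs_mv.
  by rewrite /= !catrevE !cats0 revK stacks_nil3.
rewrite /= size_enc_pair /= ?catrevE ?cats0 ?size_rev; lia.
Qed.

Lemma polytime_snd : polytime (fun p : A * B => p.2).
Proof.
exists (Then split_delimit (clear 1)).
exists (fun p => 20 * (1 + size (enc p))); split.
  by bound_tac.
move=> [a b]; apply: runs_weak.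
  rewrite -[stacks [:: enc _]]stacks_nil3.
  apply: runs_then; first exact: runs_split_delimit.
  rewrite undelimitK /=.
  apply: runs_eq; first exact: runs_clear.
  by rewrite stacks_nil3.
rewrite /= size_enc_pair /= ?catrevE ?cats0 ?size_rev; lia.
Qed.

Lemma polytime_cat_enc (f : A * B -> C) :
  (forall p, enc (f p) = enc p.1 ++ enc p.2) -> polytime f.
Proof.
move=> fE; exists (Then split_delimit (mv 1 0)).
exists (fun p => 20 * (1 + size (enc p))); split.
  by bound_tac.
move=> [a b]; apply: runs_weak.
  rewrite -[stacks [:: enc _]]stacks_nil3.
  apply: runs_then; first exact: runs_split_delimit.
  rewrite undelimitK /= fE /=.
  apply: runs_eq; first by apply: runs_mv.
  by rewrite /= !catrevE !cats0 revK stacks_nil3.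
rewrite /= size_enc_pair /= ?catrevE ?cats0 ?size_rev; lia.
Qed.

Fixpoint push_word r (w : bitseq) : prog :=
  if w is b :: w' then Then (push_word r w') (Push r b) else Skip.

Lemma runs_push_word w x : runs (push_word 0 w) (stacks [:: x]) (stacks [:: w ++
  x])
  (1 + size w).
Proof.
elim: w => [|b w IH] /=; first exact: runs_skip.
rewrite addnS -addn1; apply: runs_then IH _; exact: stacks_push.
Qed.

Lemma polytime_const (b : B) : polytime (fun _ : A => b).
Proof.
exists (Then (clear 0) (push_word 0 (enc b))).
exists (fun a => 4 * (1 + size (enc a)) + (1 + size (enc b))); split.
  by bound_tac.
move=> a; apply: runs_then; first exact: runs_clear.
by apply: runs_eq; [exact: runs_push_word | rewrite cats0].
Qed.

End PolyTimeClosure.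

Lemma polytime_cond A B {eA : encodable A} {eB : encodable B} (f g : A -> B) :
  polytime f -> polytime g -> polytime (fun p :
    bool * A => if p.1 then f p.2 else g p.2).
Proof.
move=> [c [T [Tp fT]]] [d [U [Up gU]]].
(* The delimited boolean takes three bits, [true], its value and [false], which are removed around
   the test. *)
exists (Then (Pop 0) (Case 0 Skip (Then (Pop 0) (Then (Pop 0) c))
  (Then (Pop 0) (Then (Pop 0) d)))).
exists (fun p => 4 + T p.2 + U p.2); split.
  apply: poly_bounded_add (poly_bounded_comp polytime_snd Up).
  exact: poly_bounded_add (poly_bounded_const _) (poly_bounded_comp polytime_snd
    Tp).
move=> [b a]; apply: (@runs_weak _ _ _ (1 + (2 + (T a + U a)).+1));
  last by rewrite /=; lia.
apply: runs_then; first exact: stacks_pop.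
apply: runs_case => /=; case: b => /=.
  apply: (@runs_weak _ _ _ (1 + (1 + T a))); last by lia.
  apply: runs_then; first exact: stacks_pop.
  rewrite /=; apply: runs_then; first exact: stacks_pop.
  exact: fT.
apply: (@runs_weak _ _ _ (1 + (1 + U a))); last by lia.
apply: runs_then; first exact: stacks_pop.
  rewrite /=; apply: runs_then; first exact: stacks_pop.
  exact: gU.
Qed.

Lemma polytime_if A B {eA : encodable A} {eB : encodable B} (t : A -> bool)
    (f g : A -> B) :
  polytime t -> polytime f -> polytime g ->
    polytime (fun a => if t a then f a else g a).
Proof.
by move=> Pt Pf Pg; apply: polytime_ext (polytime_comp (polytime_pair Pt
  polytime_id) (polytime_cond Pf Pg)) _.
Qed.

Lemma polytime_nilp : polytime (fun w : bitseq => nilp w).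
Proof.
exists (Case 0 (Push 0 true) (Then (clear 0) (Push 0 false))
  (Then (clear 0) (Push 0 false))).
exists (fun a => 2 + 4 * (1 + size (enc a))); split.
  by bound_tac.
case=> [|b w] /=.
  apply: (@runs_weak _ _ _ 2) => //; apply: runs_case => /=.
  exact: (stacks_push [:: [::]]).
apply: (@runs_weak _ _ _ (4 * (size w).+2 + 1).+1); last by rewrite /enc /=;
  lia.
apply: runs_case.
by case: b; apply: (runs_then (runs_clear _ _)); exact: (stacks_push [:: [::]]).
Qed.

Lemma polytime_behead : polytime (fun w : bitseq => behead w).
Proof.
exists (Pop 0), (fun=> 1); split; first exact: poly_bounded_const.
by move=> w; exact: stacks_pop.
Qed.

Lemma polytime_head : polytime (fun w : bitseq => head false w).
Proof.
exists (Case 0 (Push 0 false) (Then (clear 0) (Push 0 true))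
  (Then (clear 0) (Push 0 false))).
exists (fun a => 2 + 4 * (1 + size (enc a))); split.
  by bound_tac.
case=> [|b w] /=.
  apply: (@runs_weak _ _ _ 2) => //; apply: runs_case => /=.
  exact: (stacks_push [:: [::]]).
apply: (@runs_weak _ _ _ (4 * (size w).+2 + 1).+1); last by rewrite /enc /=;
  lia.
apply: runs_case.
by case: b; apply: (runs_then (runs_clear _ _)); exact: (stacks_push [:: [::]]).
Qed.

Lemma polytime_explode : polytime (fun w : bitseq => [seq [:: b] | b <- w]).
Proof.
exists (Then (mv 0 1) (forbits 1
  (fun b => Then (Push 0 false) (Then (Push 0 b) (Push 0 true))))).
exists (fun w => 10 * (1 + size (enc w))); split; first by bound_tac.
move=> w; apply: (@runs_weak _ _ _ (4 * (size w).+1 + 6 * (size w).+1));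
  last first.
  by rewrite /enc /enc_bits; lia.
apply: runs_then; first exact: runs_mv.
rewrite /= catrevE cats0 -[stacks [:: enc _]]stacks_nil /=.
have -> : enc [seq [:: b] | b <- w] =
    foldl (fun v b => [:: true, b, false & v]) [::] (rev w).
  rewrite -[w in LHS]revK; elim/last_ind: (rev w) => // x b IH.
  by rewrite foldl_rcons rev_rcons -IH.
pose S x (v : bitseq) := stacks [:: v; x].
rewrite -(size_rev w); apply: (@runs_forbits _ S _ _ _ 3 _ _ (rev w) [::]) =>
  // b x v.
rewrite /S upd_stacks /=.
apply: (@runs_then _ _ _ _ _ 1 _); first exact: stacks_push.
apply: (@runs_then _ _ _ _ _ 1 _); first exact: stacks_push.
exact: stacks_push.
Qed.

Lemma enc_cons A {eA : encodable A} (a : A) (l : seq A) :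
  enc (a :: l) = delimit (enc a) ++ enc l.
Proof. by []. Qed.

Lemma enc_cat A {eA : encodable A} (l l' : seq A) :
  enc (l ++ l') = enc l ++ enc l'.
Proof. by rewrite /enc /enc_seq map_cat flatten_cat. Qed.

Lemma delimit_neq0 w x : delimit w ++ x <> [::].
Proof. by rewrite /delimit; case: w. Qed.

(* In the loop, register 0 holds the rest of the list and register 4 the
   reversed encoding of the accumulator. *)
Definition fold_loop (c : prog) : prog :=
  While 0 (Then split_delimit (Then (mv 1 3) (Then (mv_delimit 4 3)
    (Then (shift_prog 3 c) (mv 3 4))))).

Definition fold_prog (c : prog) : prog :=
  Then split_delimit (Then (mv 1 3) (Then (mv 3 4)
    (Then (fold_loop c) (mv 4 0)))).

(** Both hypotheses range over prefixes of the actual list: time and size need control only on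
    accumulators that occur, and [M] bounds both. *)
Lemma runs_fold_loop A B {eA : encodable A} {eB : encodable B}
    (step : B * A -> B) c (l : seq A) b M :
  (forall l1 a l2, l = l1 ++ a :: l2 ->
     let acc := foldl (fun b a => step (b, a)) b l1 in
     runs c (stacks [:: enc (acc, a)]) (stacks [:: enc (step (acc, a))]) M) ->
  (forall l1 l2, l = l1 ++ l2 ->
     size (enc (foldl (fun b a => step (b, a)) b l1)) <= M) ->
  runs (fold_loop c) (stacks [:: enc l; [::]; [::]; [::]; rev (enc b)])
    (stacks [:: [::]; [::]; [::]; [::];
      rev (enc (foldl (fun b a => step (b, a)) b l))])
    (30 * (1 + size (enc l) + M) * (1 + size l)).
Proof.
elim: l b => [|a l IH] b cM sM.
  by apply: (@runs_weak _ _ _ 1); [exact: runs_stop | lia].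
have b0 := sM [::] _ erefl; have b1 := sM [:: a] _ erefl.
have /= ca := cM [::] a l erefl.
rewrite /= in b0 b1 *.
apply: (@runs_weak _ _ _ ((7 * (size (enc (a :: l))).+1 +
  (4 * (size (enc a)).+1 + (6 * (size (enc b)).+1 +
   (M + 4 * (size (enc (step (b, a)))).+1)))
  + 30 * (1 + size (enc l) + M) * (1 + size l)).+1)); last first.
  rewrite enc_cons size_cat size_delimit /=; nia.
apply: (@runs_step _ _ _ (stacks [:: enc l; [::]; [::]; [::];
  rev (enc (step (b, a)))])).
- exact: delimit_neq0.
- apply: runs_then; first exact: runs_split_delimit.
  rewrite enc_cons undelimitK /= catrevE cats0 -(size_rev (enc a)).
  apply: runs_then; first exact: runs_mv.
  rewrite /= catrevE cats0 revK -(size_rev (enc b)).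
  apply: runs_then; first exact: runs_mv_delimit.
  rewrite /= revK; apply: runs_then.
    rewrite (stacks_nil [:: _; _; _; _]).
    exact: (runs_shift [:: enc l; [::]; [::]] ca).
  apply: runs_eq; first exact: runs_mv.
  by rewrite /= catrevE cats0.
- apply: IH => [l1 a' l2 ll|l1 l2 ll].
    by apply: (cM (a :: l1) a' l2); rewrite ll.
  by apply: (sM (a :: l1) l2); rewrite ll.
Qed.

Lemma runs_fold A B {eA : encodable A} {eB : encodable B} (step : B * A -> B)
    c (l : seq A) b M :
  (forall l1 a l2, l = l1 ++ a :: l2 ->
     let acc := foldl (fun b a => step (b, a)) b l1 in
     runs c (stacks [:: enc (acc, a)]) (stacks [:: enc (step (acc, a))]) M) ->
  (forall l1 l2, l = l1 ++ l2 ->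
     size (enc (foldl (fun b a => step (b, a)) b l1)) <= M) ->
  runs (fold_prog c) (stacks [:: enc (b, l)])
    (stacks [:: enc (foldl (fun b a => step (b, a)) b l)])
    (60 * (1 + size (enc l) + M) * (1 + size l)).
Proof.
move=> cM sM; have b0 := sM [::] _ erefl; have := sM l [::].
rewrite cats0 /= => /(_ erefl) b1; rewrite /= in b0.
apply: runs_weak.
  rewrite -[stacks [:: enc (_, _)]]stacks_nil3.
  apply: runs_then; first exact: runs_split_delimit.
  rewrite undelimitK /= catrevE cats0 -[stacks _]stacks_nil /=.
  apply: runs_then; first exact: runs_mv.
  rewrite /= catrevE cats0 revK.
  apply: runs_then; first exact: runs_mv.
  rewrite /= catrevE cats0.
  apply: runs_then; first exact: runs_fold_loop cM sM.
  apply: runs_eq; first exact: runs_mv.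
  by rewrite /= catrevE cats0 revK (stacks_nil [:: _; _; _; _]) stacks_nil4.
rewrite size_enc_pair /= !size_rev; nia.
Qed.

Lemma size_enc_seq A {eA : encodable A} (l : seq A) : size l <= size (enc l).
Proof.
elim: l => //= a l IH; rewrite enc_cons size_cat size_delimit; lia.
Qed.

Lemma size_enc_mid A {eA : encodable A} (a : A) (l1 l2 : seq A) :
  size (enc a) <= size (enc (l1 ++ a :: l2)).
Proof. rewrite enc_cat enc_cons 2!size_cat size_delimit; lia. Qed.

Section Fold.
Context {E A B : Type} {eE : encodable E} {eA : encodable A} {eB : encodable B}.

(** The bound [S] on intermediate accumulators cannot be dispensed with: a polynomial-time step may
    double its accumulator, and iterating it would be exponential. The environment [e] travels
    inside the accumulator of [step'], because the program of a step sees only its argument. *)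
Lemma polytime_foldl (step : E -> B -> A -> B) (init : E -> B) (l : E ->
  seq A) :
  polytime (fun p : (E * B) * A => step p.1.1 p.1.2 p.2) -> polytime init ->
    polytime l ->
  (exists2 S : E -> nat, poly_bounded S & forall e l1 l2, l e = l1 ++ l2 ->
     size (enc (foldl (step e) (init e) l1)) <= S e) ->
  polytime (fun e => foldl (step e) (init e) (l e)).
Proof.
move=> Ps Pi Pl [S Sp accS].
pose step' (p : (E * B) * A) := (p.1.1, step p.1.1 p.1.2 p.2).
have step'E e b l1 : foldl (fun b a => step' (b, a)) (e, b) l1 =
    (e, foldl (step e) b l1) by elim: l1 b => //= a l1 IH b; rewrite IH.
have Ps' : polytime step' by exact: polytime_pair (polytime_comp polytime_fst
  polytime_fst) Ps.
have [c [T [[K TK] cT]]] := Ps'.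
have Pil : polytime (fun e => ((e, init e),
  l e)) by exact: polytime_pair (polytime_pair polytime_id Pi) Pl.
have [d [U [Up dU]]] := Pil.
suff : @polytime _ _ eE (@enc_pair _ _ eE eB) (fun e => (e,
  foldl (step e) (init e) (l e))).
  by move=> P; apply: polytime_ext (polytime_comp P polytime_snd) _.
(* [N] bounds the argument of a step, so [N e ^ K] bounds its time. *)
pose (N := fun e => 6 * (1 + size (enc e) + S e + size (enc (l e)))).
pose (M := fun e => N e + N e ^ K).
exists (Then d (fold_prog c)).
exists (fun e => U e + 60 * (1 + size (enc (l e)) + M e) * (1 + size (enc (l
  e)))).
have Ls := polytime_size Pl.
have Np : poly_bounded N by apply: poly_bounded_mul; bound_tac.
have Mp : poly_bounded M by apply: poly_bounded_add => //;
  apply: poly_bounded_exp.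
split; first by bound_tac.
move=> e; apply: runs_then (dU e) _.
rewrite -step'E; apply: runs_weak.
  apply: (@runs_fold _ _ _ _ step' c (l e) (e, init e) (M e)).
    move=> l1 a l2 ll /=; rewrite step'E.
    apply: runs_weak (cT _) _; apply: leq_trans (TK _) _.
    apply: leq_trans (leq_addl _ _).
    case: (K) => // K'; rewrite leq_exp2r //.
    rewrite !size_enc_pair /= /N.
    have := accS e l1 _ ll; have := @size_enc_mid _ eA a l1 l2; rewrite -ll.
    lia.
  move=> l1 l2 ll; rewrite step'E size_enc_pair /= /M /N.
  by have := accS e l1 _ ll; lia.
by rewrite leq_mul // leq_add // size_enc_seq.
Qed.
End Fold.

(** * Agreement of [poly_time] and [polytime] *)

Fixpoint regs (c : prog) : nat :=
  match c with
  | Skip => 0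
  | Push r _ | Pop r => r.+1
  | Then c1 c2 => maxn (regs c1) (regs c2)
  | Case r c0 c1 c2 => maxn r.+1 (maxn (regs c0) (maxn (regs c1) (regs c2)))
  | While r c => maxn r.+1 (regs c)
  end.

Lemma exec_regs c s t s' r : exec c s t s' -> regs c <= r -> s' r = s r.
Proof.
elim=> {c s t s'} //=.
- by move=> s r' b h; case: eqVneq => // E; lia.
- by move=> s r' h; case: eqVneq => // E; lia.
- by move=> c1 c2 s s1 s2 t1 t2 _ e1 _ e2 h; rewrite e2 ?e1 //; lia.
- move=> r' c0 c1 c2 s s' t _ e h; apply: e.
  by case: (s r') => [|[] ?]; lia.
- by move=> r' c s s1 s2 t1 t2 _ _ e1 _ e2 h; rewrite e2 ?e1 //; lia.
Qed.

Fixpoint clear_upto (r : nat) : prog :=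
  if r is r'.+1 then Then (clear r) (clear_upto r') else Skip.

Lemma runs_clear_upto r x l : size l = r ->
  runs (clear_upto r) (stacks (x :: l)) (stacks [:: x])
    (1 + 4 * sumn [seq (size w).+1 | w <- l]).
Proof.
elim: r l => [|r IH] l.
  by case: l => //= _; apply: runs_weak (runs_skip _) _; lia.
case/lastP: l => // l w; rewrite size_rcons => -[lr].
rewrite /= map_rcons sumn_rcons.
apply: (@runs_weak _ _ _ (4 * (size w).+1 + (1 + 4 * sumn [seq (size w).+1 | w
  <- l]))); last by lia.
apply: runs_then (IH _ lr).
have := @runs_clear r.+1 (x :: rcons l w).
rewrite -upd_stacks /= nth_rcons lr ltnn eqxx; congr runs.
apply: funext => k; rewrite updE /stacks.
case: eqVneq => [->|kr] /=; first by rewrite nth_default // lr.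
case: k kr => // k kr /=; rewrite nth_rcons lr.
case: ltngtP => // [h|h]; first by rewrite nth_default // lr ltnW.
by rewrite h eqxx in kr.
Qed.

Lemma poly_le_exp (p : {poly nat}) : exists K, forall n, (p.[n]%R <=
  n.+2 ^ K)%N.
Proof.
elim/poly_ind: p => [|p c [K IH]]; first by exists 0 => n; rewrite horner0.
exists (K + c).+1 => n; rewrite hornerMXaddC.
have h : c <= n.+2 ^ c by rewrite ltnW // ltn_expl.
have := IH n; rewrite expnS expnD.
set a := n.+2 ^ K; set b := n.+2 ^ c in h *; move: p.[n]%R => q qa.
have a0 : 0 < a by rewrite expn_gt0.
have b0 : 0 < b by rewrite expn_gt0.
have -> : (q * n + c)%R = q * n + c by [].
apply: (@leq_trans (a * n * b + a * b)); last by nia.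
apply: leq_add; first by rewrite -[q * n]muln1 !leq_mul.
by rewrite -[c]mul1n leq_mul.
Qed.

(** A given program may leave garbage. Only the finitely many registers it mentions can hold any,
    each at most as many bits as the running time, so clearing them is cheap. *)
Lemma polytime_of_poly_time (f : bitseq -> bitseq) : poly_time f -> polytime f.
Proof.
case=> c [p fT]; have [K pK] := poly_le_exp p.
pose r := (regs c).
exists (Then c (clear_upto r)).
exists (fun w => p.[size (enc w)]%R + (1 + 4 * (r * (1 + p.[size (enc w)]%R)))).
have pp : poly_bounded (fun w : bitseq => p.[size (enc w)]%R) by exists K.
split; first by bound_tac.
move=> w; have [t [s [e s0 tp]]] := fT w.
rewrite input_storeE in e.
apply: (@runs_then _ _ _ s); first by exists t.
pose l := mkseq (fun k => s k.+1) r.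
have -> : s = stacks (f w :: l).
  apply: funext => -[|k]; rewrite /stacks /= ?s0 //.
  have [kr|rk] := ltnP k r; first by rewrite nth_mkseq.
  rewrite nth_default ?size_mkseq // (exec_regs e) //; last by rewrite ltnW.
  by rewrite /stacks /= nth_nil.
apply: runs_weak; first by apply: runs_clear_upto; rewrite size_mkseq.
rewrite leq_add2l leq_mul2l /=.
have : all (fun n => n <= 1 + p.[size (enc w)]%R) [seq (size w).+1 | w <- l].
  apply/allP => n /mapP [x /mapP [k _ ->] ->].
  by have := exec_size e k.+1; rewrite /stacks /= nth_nil /= /enc /enc_bits;
    lia.
rewrite -[r in r * _](size_mkseq (fun k => s k.+1)) -/l -(size_map (fun w =>
  (size w).+1)).
elim: [seq _ | _ <- _] => //= n ns IH /andP [n1 /IH]; lia.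
Qed.

Lemma poly_time_of_polytime (f : bitseq -> bitseq) : polytime f -> poly_time f.
Proof.
case=> c [T [[K TK] fT]].
exists c, (('X + 2%:P) ^+ K)%R => w.
have [t e tT] := fT w; exists t, (stacks [:: f w]); split => //.
  by rewrite input_storeE.
apply: leq_trans tT _; apply: leq_trans (TK w) _.
rewrite horner_exp hornerD hornerX hornerC.
rewrite (_ : (size w + 2)%R = (size w).+2); last exact: addn2.
by rewrite natrXE.
Qed.

(** * Combinators for functions of an environment *)

Section Open.
Context {E A B C : Type} {eE : encodable E} {eA : encodable A}
  {eB : encodable B} {eC : encodable C}.

Lemma polytime_fst1 (f : E -> A * B) : polytime f ->
  polytime (fun e => (f e).1).
Proof. by move=> Pf; apply: polytime_ext (polytime_comp Pf polytime_fst) _. Qed.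

Lemma polytime_snd1 (f : E -> A * B) : polytime f ->
  polytime (fun e => (f e).2).
Proof. by move=> Pf; apply: polytime_ext (polytime_comp Pf polytime_snd) _. Qed.

Lemma polytime_cons (f : E -> A) (l : E -> seq A) :
  polytime f -> polytime l -> polytime (fun e => f e :: l e).
Proof. by move=> Pf Pl; apply: (polytime_enc (i :=
  id) (polytime_pair Pf Pl)). Qed.

Lemma polytime_cat (f g : E -> seq A) : polytime f -> polytime g ->
  polytime (fun e => f e ++ g e).
Proof.
move=> Pf Pg; apply: polytime_ext (polytime_comp (polytime_pair Pf Pg)
  (@polytime_cat_enc _ _ _ _ _ _ (fun p :
    seq A * seq A => p.1 ++ p.2) _)) _ => // p.
exact: enc_cat.
Qed.

Lemma polytime_catb (f g : E -> bitseq) : polytime f -> polytime g ->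
  polytime (fun e => f e ++ g e).
Proof.
by move=> Pf Pg; apply: polytime_ext (polytime_comp (polytime_pair Pf Pg)
  (@polytime_cat_enc _ _ _ _ _ _ (fun p : bitseq * bitseq => p.1 ++ p.2) _)) _.
Qed.

Lemma polytime_nilpb (f : E -> bitseq) : polytime f ->
  polytime (fun e => nilp (f e)).
Proof. by move=> Pf; apply: polytime_ext (polytime_comp Pf polytime_nilp) _.
  Qed.

Lemma polytime_headb (f : E -> bitseq) : polytime f ->
  polytime (fun e => head false (f e)).
Proof. by move=> Pf; apply: polytime_ext (polytime_comp Pf polytime_head) _.
  Qed.

Lemma polytime_beheadb (f : E -> bitseq) : polytime f ->
  polytime (fun e => behead (f e)).
Proof. by move=> Pf; apply: polytime_ext (polytime_comp Pf polytime_behead) _.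
  Qed.

Lemma polytime_explodeb (f : E -> bitseq) : polytime f ->
  polytime (fun e => [seq [:: b] | b <- f e]).
Proof. by move=> Pf; apply: polytime_ext (polytime_comp Pf polytime_explode) _.
  Qed.

Lemma polytime_nilp_seq (l : E -> seq A) : polytime l ->
  polytime (fun e => nilp (l e)).
Proof.
move=> Pl; have Pe : polytime (fun e => (enc (l e) : bitseq)).
  exact: (polytime_enc (i := id) Pl).
apply: polytime_ext (polytime_nilpb Pe) _ => e; case: (l e) => // a l'.
by rewrite enc_cons /nilp size_cat size_delimit.
Qed.
End Open.

(** With [a0] appended the list is nonempty, hence encoded like the pair of its head and tail, and
    the first projection applies. *)
Lemma polytime_head_seq E A {eE : encodable E} {eA : encodable A} (a0 : A)
    (l : E -> seq A) : polytime l -> polytime (fun e => head a0 (l e)).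
Proof.
move=> Pl.
have P := polytime_cat Pl (polytime_const (A := E) [:: a0]).
have P' : polytime (fun e => (head a0 (l e), behead (l e ++ [:: a0]))).
  by apply: (polytime_enc (i := id) P) => // e; case: (l e).
exact: polytime_fst1 P'.
Qed.

Lemma polytime_not E {eE : encodable E} (f : E -> bool) : polytime f ->
  polytime (fun e => ~~ f e).
Proof.
move=> Pf; apply: polytime_ext (polytime_if Pf (polytime_const false)
  (polytime_const true)) _.
by move=> e; case: (f e).
Qed.

Lemma polytime_and E {eE : encodable E} (f g : E -> bool) :
  polytime f -> polytime g -> polytime (fun e => f e && g e).
Proof.
move=> Pf Pg; apply: polytime_ext (polytime_if Pf Pg (polytime_const false)) _.
by move=> e; case: (f e).
Qed.

Lemma polytime_or E {eE : encodable E} (f g : E -> bool) :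
  polytime f -> polytime g -> polytime (fun e => f e || g e).
Proof.
move=> Pf Pg; apply: polytime_ext (polytime_if Pf (polytime_const true) Pg) _.
by move=> e; case: (f e).
Qed.

Lemma polytime_bit E {eE : encodable E} (f : E -> bool) : polytime f ->
  polytime (fun e => [:: f e]).
Proof. by move=> Pf; apply: (polytime_enc (i := id) Pf). Qed.

Lemma polytime_drop E {eE : encodable E} k (f : E -> bitseq) :
  polytime f -> polytime (fun e => drop k (f e)).
Proof.
elim: k f => [|k IH] f Pf; first by apply: polytime_ext Pf _ => e;
  rewrite drop0.
apply: polytime_ext (IH _ (polytime_beheadb Pf)) _ => e.
by case: (f e) => // b w; rewrite drop0.
Qed.

Lemma polytime_eq_word E {eE : encodable E} (u : bitseq) (f : E -> bitseq) :
  polytime f -> polytime (fun e => f e == u).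
Proof.
elim: u f => [|b u IH] f Pf.
  by apply: polytime_ext (polytime_nilpb Pf) _ => e; case: (f e).
have Pb : polytime (fun e => if b then head false (f e) else ~~ head false (f
  e)).
  by case: b; [exact: polytime_headb | apply: polytime_not;
    exact: polytime_headb].
apply: polytime_ext (polytime_if (polytime_nilpb Pf) (polytime_const false)
  (polytime_and Pb (IH _ (polytime_beheadb Pf)))) _ => e.
by case: (f e) => [|[] w]; case: b {Pb IH}.
Qed.

Lemma polytime_foldlb E B {eE : encodable E} {eB : encodable B}
    (step : E -> B -> bool -> B) (init : E -> B) (w : E -> bitseq) :
  polytime (fun p : (E * B) * bool => step p.1.1 p.1.2 p.2) -> polytime init ->
    polytime w ->
  (exists2 S : E -> nat, poly_bounded S & forall e w1 w2, w e = w1 ++ w2 ->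
     size (enc (foldl (step e) (init e) w1)) <= S e) ->
  polytime (fun e => foldl (step e) (init e) (w e)).
Proof.
move=> Ps Pi Pw [S Sp bS].
pose step' e acc (x : bitseq) := step e acc (head false x).
have stepE e acc w1 : foldl (step' e) acc [seq [:: b] | b <- w1] =
    foldl (step e) acc w1 by elim: w1 acc => //= b w1 IH acc; rewrite IH.
apply: (polytime_ext (f := fun e => foldl (step' e) (init e) [seq [:: b] | b <-
  w e]));
  last by move=> e; rewrite stepE.
apply: polytime_foldl Pi (polytime_explodeb Pw) _.
  by apply: polytime_ext (polytime_comp (polytime_pair polytime_fst
    (polytime_headb polytime_snd)) Ps) _.
exists S => // e l1 l2 ll.
have -> : l1 = [seq [:: b] | b <- take (size l1) (w e)].
  by rewrite map_take ll take_size_cat.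
by rewrite stepE; apply: (bS _ _ (drop (size l1) (w e))); rewrite cat_take_drop.
Qed.

Section FlatMap.
Context {E A B : Type} {eE : encodable E} {eA : encodable A} {eB :
  encodable (seq B)}.
Hypothesis eBcat : forall l l' : seq B, enc (l ++ l') = enc l ++ enc l'.
Hypothesis eBnil : enc ([::] : seq B) = [::].

Lemma polytime_flatmap_gen (g : E -> A -> seq B) (l : E -> seq A) :
  polytime (fun p : E * A => g p.1 p.2) -> polytime l ->
  polytime (fun e => flatten [seq g e a | a <- l e]).
Proof.
move=> Pg Pl.
have foldlE e acc l1 : foldl (fun acc a => acc ++ g e a) acc l1 =
    acc ++ flatten [seq g e a | a <- l1].
  by elim: l1 acc => [|a l1 IH] acc /=; rewrite ?cats0 // IH catA.
apply: (polytime_ext (f := fun e => foldl (fun acc a =>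
  acc ++ g e a) [::] (l e)));
  last by move=> e; rewrite foldlE.
apply: (polytime_foldl _ _ Pl); last 1 first.
- have [K gK] := polytime_size Pg.
  exists (fun e => size (enc (l e)) * (2 * (size (enc e)) + size (enc (l e)) +
    3) ^ K).
    by have Ls := polytime_size Pl; apply: poly_bounded_mul => //;
      apply: poly_bounded_exp; bound_tac.
  suff gl e l0 l1 l2 : l e = l0 ++ l1 ++ l2 ->
      size (@enc _ eB (flatten [seq g e a | a <- l1])) <= size l1 *
      (2 * size (@enc _ eE e) + size (@enc _ (@enc_seq _ eA) (l e)) + 3) ^ K.
    move=> e l1 l2 ll; rewrite foldlE cat0s.
    apply: leq_trans (gl e [::] l1 l2 ll) _; rewrite leq_mul2r; apply/orP;
      right.
    by apply: leq_trans (size_enc_seq _); rewrite ll size_cat leq_addr.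
  elim: l1 l0 => [|a l1 IH] l0 ll; first by rewrite eBnil.
  rewrite /= eBcat size_cat mulSn leq_add //; last first.
    by apply: (IH (rcons l0 a)); rewrite ll cat_rcons.
  apply: leq_trans (gK (e, a)) _; case: (K) => // K'.
  rewrite leq_exp2r // size_enc_pair /= ll.
  have := @size_enc_mid _ eA a l0 (l1 ++ l2); rewrite /=; lia.
- have Pc : polytime (fun p : seq B * seq B => p.1 ++ p.2).
    by apply: polytime_cat_enc => p; exact: eBcat.
  apply: polytime_ext (polytime_comp (polytime_pair (polytime_snd1 polytime_fst)
    (polytime_comp (polytime_pair (polytime_fst1 polytime_fst) polytime_snd)
      Pg)) Pc) _ => -[[e acc] a] //.
- exact: polytime_const.
Qed.
End FlatMap.

Section Map.
Context {E A B : Type} {eE : encodable E} {eA : encodable A} {eB : encodable B}.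

Lemma polytime_flatmap (g : E -> A -> seq B) (l : E -> seq A) :
  polytime (fun p : E * A => g p.1 p.2) -> polytime l ->
  polytime (fun e => flatten [seq g e a | a <- l e]).
Proof. by apply: polytime_flatmap_gen => // l1 l2; exact: enc_cat. Qed.

Lemma polytime_map (g : E -> A -> B) (l : E -> seq A) :
  polytime (fun p : E * A => g p.1 p.2) -> polytime l ->
    polytime (fun e => [seq g e a | a <- l e]).
Proof.
move=> Pg Pl; apply: polytime_ext (polytime_flatmap (polytime_cons Pg
  (polytime_const [::])) Pl) _ => e.
by rewrite -[RHS]flatten_seq1 -map_comp.
Qed.

End Map.

Section Filter.
Context {E A : Type} {eE : encodable E} {eA : encodable A}.

Lemma polytime_filter (t : E -> A -> bool) (l : E -> seq A) :
  polytime (fun p : E * A => t p.1 p.2) -> polytime l ->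
    polytime (fun e => [seq a <- l e | t e a]).
Proof.
move=> Pt Pl.
apply: (polytime_ext (f := fun e => flatten [seq if t e a then [:: a] else [::]
  | a <- l e])).
  apply: (polytime_flatmap _ Pl); apply: (polytime_if Pt _ (polytime_const _)).
  exact: polytime_cons polytime_snd (polytime_const _).
move=> e.
by elim: (l e) => //= a l' ->; case: ifP.
Qed.

Lemma polytime_has (t : E -> A -> bool) (l : E -> seq A) :
  polytime (fun p : E * A => t p.1 p.2) -> polytime l ->
    polytime (fun e => has (t e) (l e)).
Proof.
move=> Pt Pl; apply: polytime_ext (polytime_not (polytime_nilp_seq
  (polytime_filter Pt Pl))) _ => e.
by rewrite /nilp size_filter -lt0n has_count.
Qed.
End Filter.

(** * The reduction *)

Section Reduction.
Variables q C Q : nat.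

Definition onehot (a : nat) : bitseq := [seq i == a | i <- iota 0 q].
Definition blocks : seq bitseq := [seq onehot a | a <- iota 0 q].

Definition extend (cand : seq bitseq) : seq bitseq :=
  flatten [seq [seq u ++ w | w <- cand] | u <- blocks].

(** Only the length of [L] counts: it is the word length in unary. *)
Definition candidates (L : bitseq) : seq bitseq :=
  foldl (fun c _ => extend c) [:: [::]] L.

(** A countdown, restarted at the next power of two whenever it expires; every expiry emits [C]
    bits, so the logarithm appears in unary without arithmetic. *)
Definition log_step (s : bitseq * (bitseq * bitseq)) :
  bitseq * (bitseq * bitseq) :=
  if nilp (behead s.1)
  then (s.2.1 ++ s.2.1, (s.2.1 ++ s.2.1, nseq C true ++ s.2.2))
  else (behead s.1, s.2).

Definition log_state (rows : seq bitseq) : bitseq * (bitseq * bitseq) :=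
  foldl (fun s _ => log_step s) ([:: true; true], ([:: true], [::])) rows.

Definition log_word (rows : seq bitseq) : bitseq := (log_state rows).2.2.

(** Every common one removes [Q] bits from the unary length [L]; the words are far if something
    remains. *)
Definition far (L a w : bitseq) : bool :=
  ~~ nilp (foldl (fun s b => (behead s.1,
    if head false s.1 && b then drop Q s.2 else s.2)) (a, L) w).2.

(** The result takes the length of [w], so the empty word serves as the zero vector of any
    length. *)
Definition orw (a w : bitseq) : bitseq :=
  (foldl (fun s b => (behead s.1, s.2 ++ [:: head false s.1 || b])) (a,
    [::]) w).2.

(* One vertex is processed: the first candidate becomes its codeword, the
   candidates close to it are discarded, and the codeword is added to the points
   of all edges through the vertex.  Isolated vertices consume no candidate,
   since their number is not bounded in terms of the number of edges. *)
Definition column_step (L : bitseq) (s : seq bitseq * seq (bitseq * bitseq)) :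
    seq bitseq * seq (bitseq * bitseq) :=
  if has (fun p => head false p.1) s.2
  then ([seq w <- s.1 | far L (head [::] s.1) w],
        [seq (behead p.1, if head false p.1 then orw p.2 (head [::] s.1) else
          p.2)
           | p <- s.2])
  else (s.1, [seq (behead p.1, p.2) | p <- s.2]).

Definition point_rows (rows : seq bitseq) : seq bitseq :=
  [seq p.2 | p <- (foldl (fun s _ => column_step (log_word rows) s)
    (candidates (log_word rows), [seq (r, [::]) | r <- rows])
    (head [::] rows)).2].

(* After [r] rows with [2 ^ j <= r < 2 ^ j.+1], the state consists of
   [2 ^ j.+1 - r] and [2 ^ j] in unary and of [C * j] bits. *)
Lemma log_stateP rows : exists j,
  [/\ size (log_state rows).2.1 = 2 ^ j, size (log_state rows).2.2 = C * j,
      size rows + size (log_state rows).1 = (2 ^ j).*2,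
      0 < size (log_state rows).1
    & size (log_state rows).1 <= 2 ^ j + (1 - size rows)].
Proof.
rewrite /log_state; elim/last_ind: rows => [|rows r [j]].
  by exists 0; rewrite muln0.
rewrite foldl_rcons size_rcons; move: (foldl _ _ _) =>
  [a [b c]] /= [bj cj aj a0 aj'].
have j0 : 0 < 2 ^ j by rewrite expn_gt0.
rewrite /log_step /nilp size_behead /=; case: eqP => a1 /=.
  by exists j.+1; rewrite !size_cat size_nseq bj cj expnS mulnS; split; lia.
by exists j; rewrite size_behead; split=> //; lia.
Qed.

Lemma log_wordP rows : 0 < size rows ->
  size (log_word rows) = C * trunc_log 2 (size rows).
Proof.
have [j [_ cj aj a0 aj'] r0] := log_stateP rows.
by rewrite /log_word cj; congr (_ * _); apply/esym/trunc_log_eq; rewrite ?expnS;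
  lia.
Qed.

Lemma log_word_ub rows : exists2 j, size (log_word rows) = C * j & 2 ^ j <=
  (size rows).+1.
Proof. by have [j [_ cj aj a0 aj']] := log_stateP rows; exists j => //;
  lia. Qed.

Lemma polytime_log_state : polytime log_state.
Proof.
apply: (polytime_foldl (step := fun _ s _ => log_step s) (init := fun=> _) (l :=
  id)).
- rewrite /log_step; apply: polytime_if.
  + by apply: polytime_nilpb; apply: polytime_beheadb; apply: polytime_fst1;
    apply: polytime_snd1; exact: polytime_fst.
  + have P1 : polytime (fun p : seq bitseq * (bitseq * (bitseq * bitseq)) *
    bitseq => p.1.2.2.1).
      by apply: polytime_fst1; apply: polytime_snd1; apply: polytime_snd1;
        exact: polytime_fst.
    have P2 : polytime (fun p : seq bitseq * (bitseq * (bitseq * bitseq)) *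
      bitseq => p.1.2.2.2).
      by apply: polytime_snd1; apply: polytime_snd1; apply: polytime_snd1;
        exact: polytime_fst.
    by apply: polytime_pair; [|apply: polytime_pair];
      apply: polytime_catb => //; exact: polytime_const.
  + apply: polytime_pair; last by apply: polytime_snd1; apply: polytime_snd1;
    exact: polytime_fst.
    by apply: polytime_beheadb; apply: polytime_fst1; apply: polytime_snd1;
      exact: polytime_fst.
- exact: polytime_const.
- exact: polytime_id.
- exists (fun e => (20 + C) * (size (enc e) + 1)); first by bound_tac.
  move=> e l1 l2 ->; have [j [bj cj aj _ aj']] := log_stateP l1.
  rewrite -/(log_state l1) !size_enc_pair bj cj.
  have s1 : size l1 <= size (@enc _ (@enc_seq _ enc_bits) (l1 ++ l2)).
    by apply: leq_trans (size_enc_seq _); rewrite size_cat leq_addr.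
  have s2 : size (@enc _ enc_bits (log_state l1).1) =
    size (log_state l1).1 by [].
  rewrite s2; have j2 : j < 2 ^ j by rewrite ltn_expl.
  have : 2 ^ j <= (size l1).+1 by lia.
  set m := size l1 in s1 aj aj' *; set M := size (enc _) in s1 *.
  set x := 2 ^ j in j2 aj aj' *; move=> xm.
  have : C * j <= C * M by rewrite leq_mul2l; apply/orP; right; lia.
  nia.
Qed.

Lemma size_enc_bits (w : bitseq) : size (enc w) = size w.
Proof. by []. Qed.

Lemma polytime_log_word : polytime log_word.
Proof. exact: polytime_snd1 (polytime_snd1 polytime_log_state). Qed.

Lemma polytime_far : polytime (fun p : bitseq * (bitseq * bitseq) =>
  far p.1 p.2.1 p.2.2).
Proof.
apply: polytime_not; apply: polytime_nilpb; apply: polytime_snd1.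
apply: (polytime_foldlb (step := fun _ (s : bitseq * bitseq) b => (behead s.1,
    if head false s.1 && b then drop Q s.2 else s.2))
  (init := fun p : bitseq * (bitseq * bitseq) => (p.2.1, p.1)) (w :=
    fun p => p.2.2)).
- have P1 : polytime (fun p : (bitseq * (bitseq * bitseq)) * (bitseq * bitseq) *
  bool => p.1.2.1).
    by apply: polytime_fst1; apply: polytime_snd1; exact: polytime_fst.
  have P2 : polytime (fun p : (bitseq * (bitseq * bitseq)) * (bitseq * bitseq) *
    bool => p.1.2.2).
    by apply: polytime_snd1; apply: polytime_snd1; exact: polytime_fst.
  apply: polytime_pair; first exact: polytime_beheadb.
  apply: polytime_if => //; last exact: polytime_drop.
  apply: polytime_and; [exact: polytime_headb | exact: polytime_snd].
- by apply: polytime_pair; [apply: polytime_fst1;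
  exact: polytime_snd | exact: polytime_fst].
- by apply: polytime_snd1; exact: polytime_snd.
- exists (fun e => 2 * size (enc e) + 1); first by bound_tac.
  move=> [L [a w]] w1 w2 /= _; rewrite !size_enc_pair /= !size_enc_bits.
  set s := foldl _ _ _; suff : size s.1 <= size a /\ size s.2 <= size L by lia.
  rewrite {}/s; elim: w1 a L => //= b w1 IH a L.
  have [h1 h2] := IH (behead a) (if head false a && b then drop Q L else L).
  rewrite size_behead in h1; split; first exact: leq_trans h1 (leq_pred _).
  by apply: leq_trans h2 _; case: ifP => // _; rewrite size_drop leq_subr.
Qed.

Lemma orwE a w : orw a w = mkseq (fun i =>
  nth false a i || nth false w i) (size w).
Proof.
rewrite /orw -[RHS]cat0s.
suff gen v : (foldl (fun s b => (behead s.1, s.2 ++ [:: head false s.1 || b]))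
    (a, v) w).2 = v ++ mkseq (fun i => nth false a i || nth false w i) (size w).
  exact: gen.
elim: w a v => [|b w IH] a v /=; first by rewrite cats0.
rewrite IH -catA /=; congr (_ ++ _); rewrite /mkseq /= nth0; congr (_ :: _).
by rewrite -add1n iotaDl -map_comp; apply: eq_map => i /=; rewrite nth_behead.
Qed.

Lemma size_orw a w : size (orw a w) = size w.
Proof. by rewrite orwE size_mkseq. Qed.

Lemma polytime_orw : polytime (fun p : bitseq * bitseq => orw p.1 p.2).
Proof.
apply: polytime_snd1.
apply: (polytime_foldlb (step := fun _ (s : bitseq * bitseq) b => (behead s.1,
    s.2 ++ [:: head false s.1 || b]))
  (init := fun p : bitseq * bitseq => (p.1, [::])) (w := snd)).
- have P1 : polytime (fun p : (bitseq * bitseq) * (bitseq * bitseq) * bool =>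
  p.1.2.1).
    by apply: polytime_fst1; apply: polytime_snd1; exact: polytime_fst.
  have P2 : polytime (fun p : (bitseq * bitseq) * (bitseq * bitseq) * bool =>
    p.1.2.2).
    by apply: polytime_snd1; apply: polytime_snd1; exact: polytime_fst.
  apply: polytime_pair; first exact: polytime_beheadb.
  apply: polytime_catb => //; apply: polytime_bit; apply: polytime_or;
    [exact: polytime_headb | exact: polytime_snd].
- by apply: polytime_pair; [exact: polytime_fst | exact: polytime_const].
- exact: polytime_snd.
- exists (fun e => 2 * size (enc e) + 1); first by bound_tac.
  move=> [a w] w1 w2 /= ->; rewrite !size_enc_pair /= !size_enc_bits.
  suff gen v : let s := foldl (fun s b => (behead s.1,
    s.2 ++ [:: head false s.1 || b]))
      (a, v) w1 in size s.1 <= size a /\ size s.2 <= size v + size w1.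
    set s := foldl _ _ _; have [h1 h2] :
      size s.1 <= size a /\ size s.2 <= size w1 := gen [::].
    rewrite size_cat; lia.
  elim: w1 a v => [|b w1 IH] a v /=; first by rewrite addn0.
  have [h1 h2] := IH (behead a) (v ++ [:: head false a || b]).
  rewrite size_behead in h1; rewrite size_cat /= in h2; split.
    exact: leq_trans h1 (leq_pred _).
  by apply: leq_trans h2 _; rewrite addn1 addSnnS.
Qed.

Lemma size_enc_seq_le A {eA : encodable A} (l : seq A) M :
  (forall l1 a l2, l = l1 ++ a :: l2 -> size (enc a) <= M) ->
  size (enc l) <= size l * (2 * M).+1.
Proof.
elim: l => //= a l IH aM; rewrite enc_cons size_cat size_delimit mulSn leq_add
  //.
  by have := aM [::] a l erefl; lia.
by apply: IH => l1 b l2 ll; apply: (aM (a :: l1) b l2); rewrite ll.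
Qed.

Lemma candidates_size (L : bitseq) : size (candidates L) = q ^ size L.
Proof.
rewrite /candidates; elim/last_ind: L => // L b IH.
rewrite foldl_rcons size_rcons expnS -IH; move: (foldl _ _ _) => c.
have -> : q = size blocks by rewrite size_map size_iota.
by rewrite /extend; elim: blocks => //= u l IHl;
  rewrite size_cat size_map IHl mulSn.
Qed.

Lemma candidates_width (L w : bitseq) : w \in candidates L ->
  size w = q * size L.
Proof.
rewrite /candidates; elim/last_ind: L w => [|L b IH] w.
  by rewrite muln0 mem_seq1 => /eqP ->.
rewrite foldl_rcons size_rcons => /flattenP[_ /mapP[u /mapP[a _ ->] ->]].
by case/mapP => w' /IH w's ->; rewrite size_cat w's size_map size_iota mulnS.
Qed.

(** Brute force is affordable: the word length is [C * j] with [2 ^ j <= (size rows).+1], and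
    [q ^ (C * j) <= (2 ^ j) ^ (q * C)] is a fixed power of the input size. *)
Lemma polytime_candidates : polytime (fun rows => candidates (log_word rows)).
Proof.
apply: (polytime_foldlb (step := fun _ c _ => extend c) (init :=
  fun=> [:: [::]])
  (w := log_word)).
- rewrite /extend; apply: polytime_flatmap (polytime_const _).
  apply: polytime_map; last by apply: polytime_snd1; apply: polytime_fst1;
    exact: polytime_fst.
  by apply: polytime_catb; [apply: polytime_snd1;
    exact: polytime_fst | exact: polytime_snd].
- exact: polytime_const.
- exact: polytime_log_word.
- exists (fun e => (size (enc e) + 1) ^ (q * C) * (2 * (q * size (enc (log_word
  e)))).+1).
    apply: poly_bounded_mul; first by apply: poly_bounded_exp; bound_tac.
    have PL := polytime_size polytime_log_word.
    apply: (poly_bounded_le (g := fun e =>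
      2 * (q * size (enc (log_word e))) + 1)).
      by move=> e; rewrite addn1.
    by bound_tac.
  move=> rows w1 w2 ww; rewrite -/(candidates w1).
  apply: leq_trans (@size_enc_seq_le _ _ (candidates w1) (q * size (enc
    (log_word rows))) _) _.
    move=> l1 w l2 E; rewrite size_enc_bits (@candidates_width w1); last first.
      by rewrite E mem_cat mem_head orbT.
    by rewrite leq_mul2l ww size_enc_bits size_cat leq_addr orbT.
  rewrite leq_mul2r; apply/orP; right; rewrite candidates_size.
  have [j Lj j2] := log_word_ub rows.
  have w1j : size w1 <= C * j by rewrite -Lj ww size_cat leq_addr.
  have jr : 2 ^ j <= size (enc rows) + 1.
    by apply: leq_trans j2 _; rewrite addn1 ltnS size_enc_seq.
  apply: (@leq_trans ((2 ^ j) ^ (q * C))); last first.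
    by case: (q * C) => // k; rewrite leq_exp2r.
  apply: (@leq_trans ((2 ^ q) ^ (C * j))).
    apply: (@leq_trans ((2 ^ q) ^ size w1));
      last by rewrite leq_pexp2l // expn_gt0.
    by case: (size w1) => // k; rewrite leq_exp2r // ltnW // ltn_expl.
  by rewrite -!expnM mulnA mulnC.
Qed.

Lemma polytime_column_step :
  polytime (fun p : bitseq * (seq bitseq * seq (bitseq * bitseq)) =>
    column_step p.1 p.2).
Proof.
rewrite /column_step; apply: polytime_if.
- apply: polytime_has; last by apply: polytime_snd1; exact: polytime_snd.
  by apply: polytime_headb; apply: polytime_fst1; exact: polytime_snd.
- apply: polytime_pair.
    apply: polytime_filter; last by apply: polytime_fst1; exact: polytime_snd.
    apply: polytime_ext (polytime_comp (polytime_pair (polytime_fst1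
      polytime_fst) (polytime_pair
      (polytime_head_seq [::] (polytime_fst1 (polytime_snd1 polytime_fst)))
        polytime_snd)) polytime_far) _ => p //.
  apply: polytime_map; last by apply: polytime_snd1; exact: polytime_snd.
  apply: polytime_pair; first by apply: polytime_beheadb; apply: polytime_fst1;
    exact: polytime_snd.
  apply: polytime_if.
  + by apply: polytime_headb; apply: polytime_fst1; exact: polytime_snd.
  + by apply: polytime_ext (polytime_comp (polytime_pair (polytime_snd1
    polytime_snd)
      (polytime_head_seq [::] (polytime_fst1 (polytime_snd1 polytime_fst))))
        polytime_orw) _ => p.
  + by apply: polytime_snd1; exact: polytime_snd.
- apply: polytime_pair; first by apply: polytime_fst1; exact: polytime_snd.
  apply: polytime_map; last by apply: polytime_snd1; exact: polytime_snd.
  apply: polytime_pair; last by apply: polytime_snd1; exact: polytime_snd.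
  by apply: polytime_beheadb; apply: polytime_fst1; exact: polytime_snd.
Qed.

Lemma size_enc_filter A {eA : encodable A} (t : pred A) (l : seq A) :
  size (enc [seq a <- l | t a]) <= size (enc l).
Proof.
elim: l => //= a l IH; rewrite [enc (a :: l)]enc_cons size_cat.
case: ifP => _; last exact: leq_trans IH (leq_addl _ _).
by rewrite enc_cons size_cat leq_add2l.
Qed.

Lemma size_head_enc (l : seq bitseq) : size (head [::] l) <= size (enc l).
Proof. by case: l => // w l; exact: (@size_enc_mid _ _ w [::] l). Qed.

(** These bounds survive the fold: candidates are only discarded, rows only lose bits, and a changed
    point takes the length of the first candidate. *)
Definition column_inv (M m : nat) (s : seq bitseq * seq (bitseq * bitseq)) :
  bool :=
  [&& size (enc s.1) <= M, size s.2 <= m &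
    all (fun p => (size p.1 <= m) && (size p.2 <= M)) s.2].

Lemma column_step_inv M m L s : column_inv M m s ->
  column_inv M m (column_step L s).
Proof.
case: s => c ps /and3P[/= cM pm /allP psM]; rewrite /column_step /=.
have hM := leq_trans (size_head_enc c) cM.
case: ifP => _; apply/and3P; split; rewrite /= ?size_map //.
- exact: leq_trans (size_enc_filter _ _) cM.
- apply/allP => _ /mapP[p /psM /andP[p1 p2] ->] /=; rewrite size_behead.
  rewrite (leq_trans (leq_pred _) p1) /=; case: ifP => _ //.
  by rewrite size_orw.
- apply/allP => _ /mapP[p /psM /andP[p1 p2] ->] /=; rewrite size_behead p2.
  by rewrite (leq_trans (leq_pred _) p1).
Qed.

Lemma column_inv_size M m s : column_inv M m s ->
  size (enc s) <= 2 * M + 1 + m * (2 * (2 * m + 1 + M)).+1.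
Proof.
case: s => c ps /and3P[/= cM pm psM]; rewrite size_enc_pair /=.
apply: leq_add; first by rewrite addn1 ltnS -mul2n leq_mul2l; exact: cM.
apply: leq_trans (@size_enc_seq_le _ _ ps (2 * m + 1 + M) _) _;
  last by rewrite leq_mul2r pm orbT.
move=> l1 p l2 E; move: psM; rewrite E all_cat /= => /and3P[_ /andP[p1 p2] _].
rewrite size_enc_pair !size_enc_bits; by rewrite leq_add // addn1 ltnS -mul2n
  leq_mul2l p1.
Qed.

Lemma polytime_point_rows : polytime point_rows.
Proof.
rewrite /point_rows; apply: polytime_map; first by apply: polytime_snd1;
  exact: polytime_snd.
apply: polytime_snd1.
apply: (polytime_foldlb (step := fun rows s _ => column_step (log_word rows) s)
  (init := fun rows => (candidates (log_word rows), [seq (r,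
    [::]) | r <- rows]))
  (w := fun rows => head [::] rows)).
- apply: polytime_ext (polytime_comp (polytime_pair (polytime_comp
  (polytime_fst1 polytime_fst) polytime_log_word)
    (polytime_snd1 polytime_fst)) polytime_column_step) _ => p //.
- apply: polytime_pair; first exact: polytime_candidates.
  apply: polytime_map; last exact: polytime_id.
  by apply: polytime_pair; [exact: polytime_snd | exact: polytime_const].
- by apply: polytime_head_seq; exact: polytime_id.
- pose (M := fun e : seq bitseq => size (enc (candidates (log_word e)))).
  pose (m := fun e : seq bitseq => size (enc e)).
  have pM : poly_bounded M := polytime_size polytime_candidates.
  have pm : poly_bounded m := poly_bounded_size.
  exists (fun e => 2 * M e + 1 + m e * (2 * (2 * m e + 1 + M e) + 1));
    first by bound_tac.
  move=> e w1 w2 _; rewrite (addn1 (2 * (2 * m e + 1 + M e)));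
    apply: column_inv_size.
  have : column_inv (M e) (m e)
      (candidates (log_word e), [seq (r, [::]) | r <- e]).
    apply/and3P; split => //=; first by rewrite size_map size_enc_seq.
    apply/allP => _ /mapP[r re ->] /=; rewrite andbT.
    case/splitPr: re => l1 l2; exact: (@size_enc_mid _ _ r).
  elim: w1 (_, _) => //= b w1 IH s sI.
  by apply: IH; exact: column_step_inv.
Qed.

(* [log_word] is empty exactly for at most one edge; such an instance is always
   complete, but its only point would not form a k-means instance. *)
Definition reduction (yes : bitseq * seq bitseq) (p : bitseq * seq bitseq) :=
  if nilp (log_word p.2) then yes else (p.1, point_rows p.2).

Lemma polytime_reduction yes : polytime (reduction yes).
Proof.
apply: polytime_if; first by apply: polytime_nilpb;
  exact: polytime_comp polytime_snd polytime_log_word.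
  exact: polytime_const.
by apply: polytime_pair; [exact: polytime_fst | exact: polytime_comp
  polytime_snd polytime_point_rows].
Qed.

End Reduction.

(** [f] may be any function, computable or not: only its finitely many values on [W] enter the
    program. *)
Lemma polytime_table A B {eA : encodable A} {eB : encodable B} (W : seq bitseq)
    (f : bitseq -> B) (g : A -> B) :
  polytime g -> polytime (fun a => if enc a \in W then f (enc a) else g a).
Proof.
move=> Pg; elim: W => [|w W IH]; first exact: polytime_ext Pg _.
have Pe : polytime (fun a : A => enc a == w).
  by apply: polytime_eq_word; exact: (polytime_enc (i := id) polytime_id).
apply: polytime_ext (polytime_if Pe (polytime_const (f w)) IH) _ => a.
by rewrite inE; case: eqP => [->|].
Qed.

(** * Greedy codewords *)

Fixpoint overlap (a w : bitseq) : nat :=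
  if w is b :: w' then (head false a && b) + overlap (behead a) w' else 0.

Lemma overlapE a w : overlap a w = \sum_(i < size w) (nth false a i && nth false
  w i).
Proof.
elim: w a => [|b w IH] a /=; first by rewrite big_ord0.
rewrite big_ord_recl IH /= nth0; congr (_ + _); apply: eq_bigr => i _.
by rewrite nth_behead.
Qed.

Lemma overlap_cat a1 a2 w1 w2 : size a1 = size w1 ->
  overlap (a1 ++ a2) (w1 ++ w2) = overlap a1 w1 + overlap a2 w2.
Proof. by elim: w1 a1 => [|b w1 IH] [|a a1] //= [/IH ->]; rewrite addnA. Qed.

Section Codes.
Variables q Q : nat.
Implicit Types (L w g : bitseq).

Lemma farE L a w : far Q L a w = (Q * overlap a w < size L).
Proof.
suff -> : far Q L a w = ~~ nilp (drop (Q * overlap a w) L).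
  by rewrite /nilp size_drop -lt0n subn_gt0.
rewrite /far; congr (~~ nilp _); elim: w a L => [|b w IH] a L /=.
  by rewrite muln0 drop0.
rewrite IH; case: (_ && b) => //=.
by rewrite drop_drop mulnDr muln1 addnC.
Qed.

Lemma overlap_onehot a b : a < q -> b < q ->
  overlap (onehot q a) (onehot q b) = (a == b).
Proof.
move=> aq bq; rewrite overlapE size_map size_iota.
rewrite (bigD1 (Ordinal bq)) //= big1 => [|i ib].
  by rewrite !(nth_map 0) ?size_iota // nth_iota // add0n eqxx andbT addn0
    eq_sym.
rewrite !(nth_map 0) ?size_iota // nth_iota // add0n -[b]/(val (Ordinal bq)).
by rewrite (inj_eq val_inj) (negbTE ib) andbF.
Qed.

Lemma candidates_cons L b w : reflect
  (exists a w', [/\ a < q, w' \in candidates q L & w = onehot q a ++ w'])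
  (w \in candidates q (rcons L b)).
Proof.
rewrite /candidates foldl_rcons -/(candidates q L) /extend.
apply: (iffP flattenP) => [[_ /mapP[u /mapP[a + ->] ->]]|[a [w' [aq w'L ->]]]].
  by rewrite mem_iota add0n => aq /mapP[w' w'L ->]; exists a, w'.
exists [seq onehot q a ++ w | w <- candidates q L]; last exact: map_f.
by apply: map_f; apply: map_f; rewrite mem_iota.
Qed.

Lemma overlap_candidates L w : w \in candidates q L -> overlap w w = size L.
Proof.
elim/last_ind: L w => [|L b IH] w; first by rewrite mem_seq1 => /eqP ->.
case/candidates_cons => a [w' [aq /IH w'L ->]].
by rewrite overlap_cat // overlap_onehot // eqxx w'L size_rcons.
Qed.

(** The sum factors over the letters. One letter contributes [q] for agreement and 1 for each of the
    [q - 1] others, which is less than [2 * q]. *)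
Lemma candidates_moment L g : g \in candidates q L ->
  \sum_(w <- candidates q L) q ^ overlap g w <= (2 * q) ^ size L.
Proof.
elim/last_ind: L g => [|L b IH] g.
  by rewrite mem_seq1 => /eqP ->; rewrite big_seq1.
case/candidates_cons => a [g' [aq /IH {}IH ->]].
rewrite {1}/candidates foldl_rcons -/(candidates q L) /extend big_flatten /=
  big_map.
rewrite big_map size_rcons expnS.
under eq_big_seq => c.
  rewrite mem_iota add0n => /= cq.
  rewrite big_map (eq_bigr (fun w => q ^ (a == c) * q ^ overlap g' w));
    last first.
    by move=> w _; rewrite overlap_cat ?size_map // overlap_onehot // expnD.
  rewrite -big_distrr /=.
  over.
rewrite -big_distrl leq_mul //= (bigD1_seq a) ?iota_uniq ?mem_iota //= eqxx
  expn1.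
rewrite mul2n -addnn leq_add2l (eq_bigr (fun=> 1)) => [|c]; last first.
  by rewrite eq_sym => /negbTE ->.
by rewrite sum1_count (leq_trans (count_size _ _)) // size_iota.
Qed.

(* Markov's inequality for [q ^ overlap g w]; [q = 8 ^ Q] turns closeness into
   [8 ^ size L <= q ^ overlap g w]. *)
Lemma count_close L g : q = 8 ^ Q -> g \in candidates q L ->
  count (fun w => ~~ far Q L g w) (candidates q L) * 4 ^ size L <= q ^ size L.
Proof.
move=> qQ /candidates_moment gm.
rewrite -(@leq_pmul2r (2 ^ size L)) ?expn_gt0 // -mulnA -!expnMn [q * 2]mulnC.
apply: leq_trans gm; rewrite -sum1_count big_distrl /= big_mkcond /=.
apply: leq_sum => w _; case: ifP => //; rewrite farE -leqNgt mul1n => wQ.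
by rewrite [in X in _ <= X]qQ -expnM leq_exp2l.
Qed.

End Codes.

Section Greedy.
Variables q C Q : nat.
Variable rows : seq bitseq.
Let L := log_word C rows.

Definition used (v : nat) : bool := has (fun r => nth false r v) rows.

Fixpoint greedy (v : nat) : seq bitseq :=
  if v is u.+1 then
    if used u then [seq w <- greedy u | far Q L (head [::] (greedy u)) w]
    else greedy u
  else candidates q L.

Definition codeword (v : nat) : bitseq := head [::] (greedy v).

Definition row_point (v : nat) (r : bitseq) : bitseq :=
  foldl (fun a i => if nth false r i then orw a (codeword i) else a) [::] (iota
    0 v).

(** The candidate list evolves independently of the points under construction, so the codewords can
    be studied on [greedy] alone. *)
Lemma column_fold (w : bitseq) :
  foldl (fun s _ => column_step Q L s)
    (candidates q L, [seq (r, [::]) | r <- rows]) w =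
  (greedy (size w), [seq (drop (size w) r, row_point (size w) r) | r <- rows]).
Proof.
elim/last_ind: w => [|w b IH] /=.
  by congr (_, _); apply: eq_map => r; rewrite drop0.
rewrite foldl_rcons size_rcons {}IH /column_step /= has_map.
set v := size w.
rewrite (@eq_has _ _ (fun r => nth false r v)); last first.
  by move=> r /=; rewrite -nth0 nth_drop addn0.
rewrite -/(used v); have pS r : row_point v.+1 r =
    if nth false r v then orw (row_point v r) (codeword v) else row_point v r.
  by rewrite /row_point -addn1 iotaD foldl_cat.
have dS (r : bitseq) : behead (drop v r) = drop v.+1 r.
  by rewrite -drop1 drop_drop add1n.
case uv: (used v); congr pair; rewrite -map_comp; apply/eq_in_map => r rr /=.
  by rewrite dS -nth0 nth_drop addn0 pS.
by rewrite dS pS; case: ifP => // rv; case/hasP: uv; exists r.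
Qed.

Lemma greedy_sub u v : u <= v -> {subset greedy v <= greedy u}.
Proof.
elim: v => [|v IH]; first by rewrite leqn0 => /eqP ->.
rewrite leq_eqVlt => /orP[/eqP -> //|/IH {}IH] w /=.
by case: ifP => _; [rewrite mem_filter => /andP[_]|]; exact: IH.
Qed.

Lemma greedy_far u v w : used u -> u < v -> w \in greedy v ->
  far Q L (codeword u) w.
Proof.
move=> uu uv /(greedy_sub uv) /=; rewrite uu mem_filter => /andP[]//.
Qed.

Hypothesis qQ : q = 8 ^ Q.

Lemma q_gt0 : 0 < q.
Proof. by rewrite qQ expn_gt0. Qed.

(** By [count_close] each used vertex discards at most the fraction 1 / 4 ^ size L of the initial
    list; the inequality is multiplied out to stay in [nat]. *)
Lemma greedy_size v : count used (iota 0 v) <= 4 ^ size L ->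
  q ^ size L * 4 ^ size L <=
  size (greedy v) * 4 ^ size L + count used (iota 0 v) * q ^ size L.
Proof.
have q0 := q_gt0.
elim: v => [|v IH]; first by rewrite /= candidates_size leq_addr.
have -> : count used (iota 0 v.+1) = count used (iota 0 v) + used v.
  by rewrite -addn1 iotaD count_cat /= addn0.
rewrite [greedy _]/=; case uv: (used v); last by rewrite addn0.
rewrite addn1 => h; apply: leq_trans (IH (ltnW h)) _.
rewrite mulSn addnA leq_add2r.
have := count_predC (far Q L (codeword v)) (greedy v);
  rewrite -size_filter => <-.
rewrite mulnDl leq_add2l.
(* [count_close] needs a genuine candidate: the induction hypothesis keeps the list nonempty, so
   [codeword v] is not the default of [head]. *)
have c : codeword v \in candidates q L.
  apply: (greedy_sub (leq0n v)); rewrite /codeword;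
    case gv: (greedy v) => [|w l].
    have := IH (ltnW h); rewrite gv mul0n add0n mulnC leq_pmul2r ?expn_gt0 ?q0
      //.
    by rewrite leqNgt h.
  exact: mem_head.
apply: leq_trans (count_close qQ c); rewrite leq_mul2r.
apply/orP; right; have : subseq (greedy v) (candidates q L).
  elim: (v) => //= v' IH'; case: ifP => // _.
  exact: subseq_trans (filter_subseq _ _) IH'.
exact: leq_count_subseq.
Qed.

Lemma code_in v : count used (iota 0 v) < 4 ^ size L -> codeword v \in greedy v.
Proof.
move=> h; have q0 := q_gt0; have := greedy_size (ltnW h); rewrite /codeword.
case: (greedy v) => [|w l _]; last exact: mem_head.
by rewrite mul0n add0n mulnC leq_pmul2r ?expn_gt0 ?q0 // leqNgt h.
Qed.

Section Bounded.
Variable n : nat.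
Hypothesis used_lt : count used (iota 0 n) <= 4 ^ size L.

Lemma code_greedy v : v < n -> used v -> codeword v \in greedy v.
Proof.
move=> vn uv; apply: code_in; apply: leq_trans used_lt.
(* [v] itself is used, so strictly fewer vertices were used before it. *)
rewrite -(subnKC (ltnW vn)) iotaD count_cat add0n -(subnSK vn) /= uv; lia.
Qed.

Lemma code_candidate v : v < n -> used v -> codeword v \in candidates q L.
Proof. by move=> vn uv; apply: (greedy_sub (leq0n v)); exact: code_greedy. Qed.

Lemma size_code v : v < n -> used v -> size (codeword v) = q * size L.
Proof. by move=> vn uv; apply: (@candidates_width q L);
  exact: code_candidate. Qed.

Lemma code_weight v : v < n -> used v ->
  overlap (codeword v) (codeword v) = size L.
Proof. by move=> vn uv; apply: (@overlap_candidates q);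
  exact: code_candidate. Qed.

Lemma code_overlap u v : u < v -> v < n -> used u -> used v ->
  Q * overlap (codeword u) (codeword v) < size L.
Proof.
by move=> uv vn uu uv'; rewrite -farE; apply: greedy_far uv _ => //;
  exact: code_greedy.
Qed.

Lemma size_row_point r : r \in rows -> has (nth false r) (iota 0 n) ->
  size (row_point n r) = q * size L.
Proof.
move=> rr; have : n <= n by []. rewrite /row_point.
elim: {1 3 4}n => // m IH mn; rewrite -addn1 iotaD has_cat foldl_cat /= add0n
  orbF.
case: ifP => rm; last by rewrite orbF; apply: IH; exact: ltnW.
by move=> _; rewrite size_orw size_code //; apply/hasP; exists r.
Qed.

Lemma nth_row_point r i : r \in rows -> i < q * size L ->
  nth false (row_point n r) i =
  has (fun v => nth false r v && nth false (codeword v) i) (iota 0 n).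
Proof.
move=> rr id; have : n <= n by []. rewrite /row_point.
elim: {1 3 4}n => [|m IH] mn; first by rewrite nth_nil.
rewrite -addn1 iotaD has_cat foldl_cat /= add0n orbF.
case: ifP => rm; last by rewrite orbF; apply: IH; exact: ltnW.
rewrite orwE nth_mkseq ?IH ?(ltnW mn) // size_code //.
by apply/hasP; exists r.
Qed.

End Bounded.

Lemma point_rowsE : point_rows q C Q rows =
  [seq row_point (size (head [::] rows)) r | r <- rows].
Proof. by rewrite /point_rows column_fold -map_comp. Qed.

End Greedy.

(** * Clusters of sets *)

Lemma card_bigcup_le (I T : finType) (P : pred I) (F : I -> {set T}) :
  #|\bigcup_(i | P i) F i| <= \sum_(i | P i) #|F i|.
Proof.
elim/big_rec2: _ => [|i a S _ IH]; first by rewrite cards0.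
by apply: leq_trans (leq_card_setU _ _) _; rewrite leq_add2l.
Qed.

Section Cluster.
Variables (n z y : nat) (A : {set {set 'I_n}}).
Hypothesis y_gt0 : 0 < y.
Hypothesis yz : y < z.
Hypothesis cardA : forall T, T \in A -> #|T| = z.

Let m := #|A|.
Let deg (v : 'I_n) := #|[set T in A | v \in T]|.
Let cont (S : {set 'I_n}) := #|[set T in A | S \subset T]|.

Lemma sum_cardI :
  \sum_(T in A) \sum_(T' in A) #|T :&: T'| = \sum_(T in A) \sum_(v in T) deg v.
Proof.
apply: eq_bigr => T _; rewrite /deg.
under eq_bigr => T' _ do rewrite -sum1_card (eq_bigl _ _ (fun v =>
  finset.in_setI v T T')) big_mkcondr.
rewrite exchange_big /=; apply: eq_bigr => v _.
by rewrite -sum1_card (eq_bigl _ _ (fun v => finset.in_set _ v)) big_mkcondr.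
Qed.

Lemma sum_deg : \sum_v deg v = z * m.
Proof.
transitivity (\sum_(T in A) #|T|).
  have cT (T : {set 'I_n}) : #|T| = \sum_v (v \in T).
    by rewrite -sum1_card big_mkcond; apply: eq_bigr => v _; case: ifP.
  rewrite [RHS](eq_bigr _ (fun T _ => cT T)) [RHS]exchange_big.
  apply: eq_bigr => v _ /=.
  by rewrite /deg -sum1_card (eq_bigl _ _ (fun v =>
    finset.in_set _ v)) big_mkcondr.
by rewrite (eq_bigr (fun=> z)) // sum_nat_const mulnC.
Qed.

Lemma deg_le v : deg v <= m.
Proof. by apply: subset_leq_card; apply/fintype.subsetP => T;
  rewrite inE => /andP[]. Qed.

(* Union bound: a member of [A] that does not contain [Y] misses a vertex of
  [Y]. *)
Lemma sum_deg_le (Y : {set 'I_n}) : \sum_(v in Y) deg v + m <=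
  #|Y| * m + cont Y.
Proof.
have h : m <= cont Y + \sum_(v in Y) (m - deg v).
  have -> : \sum_(v in Y) (m - deg v) =
      \sum_(T in A) \sum_(v in Y) (v \notin T).
    rewrite exchange_big; apply: eq_bigr => v _ /=.
    rewrite /m -sum1_card /deg -sum1_card (eq_bigl _ _ (fun v =>
      finset.in_set _ v)) big_mkcondr.
    rewrite -sumnB => [|T _]; last by case: ifP.
    by apply: eq_bigr => T _; case: (v \in T).
  rewrite /cont /m -!sum1_card (eq_bigl _ _ (fun v =>
    finset.in_set _ v)) big_mkcondr.
  rewrite -big_split; apply: leq_sum => T _ /=.
  case: ifPn => // /fintype.subsetPn[v vY vT].
  by rewrite (bigD1 v) //= vT.
have : \sum_(v in Y) deg v + \sum_(v in Y) (m - deg v) = #|Y| * m.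
  by rewrite -big_split -sum_nat_const; apply: eq_bigr => v _ /=;
    rewrite subnKC // deg_le.
lia.
Qed.

Lemma bin_le_exp a b : 'C(a, b) <= a ^ b.
Proof.
apply: (@leq_trans (a ^_ b)); first by rewrite -bin_ffact leq_pmulr // fact_gt0.
elim: b a => // b IH [|a]; first by rewrite ffact0n.
rewrite ffactnS expnS leq_mul //=; apply: leq_trans (IH a) _.
by case: b {IH} => // b; rewrite leq_exp2r.
Qed.

(** [T] is determined by [T :\: X], a set of [z - #|X|] elements. *)
Lemma card_supersets (X : {set 'I_n}) : #|X| <= z ->
  #|[set T : {set 'I_n} | (#|T| == z) && (X \subset T)]| <= n ^ (z - #|X|).
Proof.
move=> Xz; set F := [set T : {set 'I_n} | _].
have inj : {in F &, injective (fun T => T :\: X)}.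
  move=> T T'; rewrite !inE => /andP[_ XT] /andP[_ XT'] E.
  by rewrite -(finset.setID T X) -(finset.setID T' X) E (finset.setIidPr XT)
    (finset.setIidPr XT').
rewrite -(card_in_imset inj).
apply: (@leq_trans #|[set S : {set 'I_n} | #|S| == z - #|X|]|).
  apply: subset_leq_card; apply/fintype.subsetP => _ /imsetP[T + ->].
  by rewrite !inE => /andP[/eqP Tz XT]; rewrite cardsD (finset.setIidPr XT) Tz.
by rewrite card_draws card_ord bin_le_exp.
Qed.

Section Heavy.
Variable K : nat.
Hypothesis K_gt0 : 0 < K.
Hypothesis m_gt0 : 0 < m.
Let H := [set v | m <= K * deg v].

Lemma card_heavy : #|H| <= z * K.
Proof.
rewrite -(@leq_pmul2r m) // -mulnA [K * m]mulnC mulnA -sum_deg -sum_nat_const.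
rewrite mulnC big_distrr /= [leqRHS](bigID (mem H)) /=.
by apply: leq_trans (leq_addr _ _); apply: leq_sum => v; rewrite inE.
Qed.

Let bad := [set T in A | y < #|T :&: H|].

(** Such an edge contains a [y.+1]-subset of [H]. There are at most [2 ^ (z * K)] of these, a bound
    independent of the instance, and each lies in at most [n ^ (z - y - 1)] sets of size [z]. *)
Lemma card_bad : #|bad| <= 2 ^ (z * K) * n ^ (z - y - 1).
Proof.
pose F (X : {set 'I_n}) := [set T : {set 'I_n} | (#|T| == z) && (X \subset T)].
apply: (@leq_trans #|\bigcup_(X in [set X in powerset H | #|X| == y.+1]) F X|).
  apply: subset_leq_card; apply/fintype.subsetP => T;
    rewrite inE => /andP[TA yT].
  have [X XT Xy] : exists2 X : {set 'I_n}, X \subset T :&: H & #|X| = y.+1.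
    have : 0 < #|[set X : {set 'I_n} | X \subset T :&: H & #|X| == y.+1]|.
      by rewrite cards_draws bin_gt0.
    by case/card_gt0P => X; rewrite inE => /andP[? /eqP]; exists X.
  move: XT; rewrite finset.subsetI => /andP[XT XH].
  apply/bigcupP; exists X; first by rewrite !inE XH Xy eqxx.
  by rewrite inE cardA // eqxx.
apply: leq_trans (card_bigcup_le _ _) _.
apply: (@leq_trans (\sum_(X in [set X in powerset H | #|X| == y.+1]) n ^ (z - y
  - 1))).
  apply: leq_sum => X; rewrite inE => /andP[_ /eqP Xy].
  by have := @card_supersets X; rewrite Xy -subnDA addn1; apply.
rewrite sum_nat_const leq_mul2r; apply/orP; right.
apply: (@leq_trans #|powerset H|).
  by apply: subset_leq_card; apply/fintype.subsetP => X; rewrite inE => /andP[].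
by rewrite card_powerset leq_exp2l // card_heavy.
Qed.

(** In the degree sum of one edge, light vertices add at most z m / K. If y vertices are heavy,
    [sum_deg_le] bounds their part by (y - 1) m + M; if fewer are, (y - 1) m suffices. A bad edge is
    charged the trivial z m. The summand [K * (m * m)] on the left stands for the -1 in y - 1. *)
Lemma cluster_bound M : (forall S : {set 'I_n}, #|S| = y -> cont S <= M) ->
  K * \sum_(T in A) \sum_(T' in A) #|T :&: T'| + K * (m * m) <=
  m * (K * (y * m) + K * M + z * m + K * (z.+1 * (2 ^ (z * K) * n ^ (z - y -
    1)))).
Proof.
move=> contM; rewrite sum_cardI.
(* The factor [z.+1], and not [z], also pays for the extra [K * m] on the left. *)
have split_T T : T \in A -> K * \sum_(v in T) deg v + K * m <=
    K * (y * m) + K * M + z * m + (T \in bad) * (K * (z.+1 * m)).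
  move=> TA; have [Tb|Tb] := boolP (T \in bad).
    have : \sum_(v in T) deg v <= z * m.
      rewrite -(cardA TA) -sum_nat_const; apply: leq_sum => v _; exact: deg_le.
    move=> h; rewrite mul1n; nia.
  rewrite mul0n addn0 (big_setID H) /=.
  have h1 : \sum_(v in T :&: H) deg v + m <= y * m + M.
    move: Tb; rewrite inE TA /= -leqNgt leq_eqVlt => /orP[/eqP Ty|Ty].
      by apply: leq_trans (sum_deg_le _) _; rewrite Ty leq_add2l contM.
    have : \sum_(v in T :&: H) deg v <= #|T :&: H| * m.
      rewrite -sum_nat_const; apply: leq_sum => v _; exact: deg_le.
    move=> h; apply: leq_trans (leq_addr _ _);
      apply: leq_trans (leq_mul Ty (leqnn m)).
    by rewrite mulSn addnC leq_add2l.
  have h2 : K * \sum_(v in T :\: H) deg v <= z * m.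
    apply: (@leq_trans (\sum_(v in T :\: H) m)).
      rewrite big_distrr /=; apply: leq_sum => v; rewrite !inE -ltnNge.
      by case/andP => /ltnW.
    rewrite sum_nat_const leq_mul2r -(cardA TA) subset_leq_card ?orbT //.
    exact: finset.subsetDl.
  rewrite mulnDr addnAC; apply: leq_add h2.
  by rewrite -!mulnDr leq_mul2l h1 orbT.
have -> : K * \sum_(T in A) \sum_(v in T) deg v + K * (m * m) =
    \sum_(T in A) (K * \sum_(v in T) deg v + K * m).
  by rewrite big_split -!big_distrr /= sum_nat_const.
apply: leq_trans (leq_sum _ split_T) _.
rewrite big_split sum_nat_const /= [leqRHS]mulnDr; apply: leq_add => //.
rewrite -big_distrl /=.
have -> : \sum_(T in A) (T \in bad) = #|bad|.
  rewrite -sum1_card [RHS]big_mkcond [LHS]big_mkcond; apply: eq_bigr => T _.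
  by rewrite [T \in bad]inE; case: (T \in A) => //=; case: ifP.
have cb := card_bad.
have -> : #|bad| * (K * (z.+1 * m)) = m * (K * (z.+1 * #|bad|)).
  by rewrite mulnC [z.+1 * m]mulnC -!mulnA mulnCA.
by rewrite !leq_mul2l cb !orbT.
Qed.

End Heavy.
End Cluster.

(** * Geometry of the points *)

Local Open Scope ring_scope.

Definition indicator (d : nat) (X : {set 'I_d}) : d.-tuple bool :=
  [tuple i \in X | i < d].

Lemma card_sum_mem (T : finType) (X : {set T}) : #|X| = (\sum_i (i \in X))%N.
Proof. by rewrite -sum1_card big_mkcond; apply: eq_bigr => i _; case: ifP. Qed.

Lemma sq_l2norm_indicator (R : realType) d (X Y : {set 'I_d}) :
  sq_l2norm (point_vector R (indicator X) - point_vector R (indicator Y)) =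
  (#|X :\: Y| + #|Y :\: X|)%N%:R.
Proof.
rewrite !card_sum_mem -big_split natr_sum; apply: eq_bigr => i _.
rewrite !mxE !tnth_mktuple !finset.in_setD.
by case: (i \in X); case: (i \in Y);
  rewrite /= ?subrr ?expr0n ?subr0 ?expr1n ?sub0r ?sqrrN ?expr1n.
Qed.

Lemma sum_sq_l2norm (R : realType) d (I : finType) (A : {set I})
    (p : I -> 'rV[R]_d) (c : 'rV[R]_d) :
  \sum_(a in A) \sum_(b in A) sq_l2norm (p a - p b) <=
  2 * #|A|%:R * \sum_(a in A) sq_l2norm (p a - c).
Proof.
(* Coordinatewise, the two sides differ by [2 * (\sum_(a in A) x a) ^+ 2]. *)
rewrite /sq_l2norm.
under eq_bigr => a _ do rewrite exchange_big /=.
rewrite exchange_big [X in _ <= _ * X]exchange_big /= big_distrr /=.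
apply: ler_sum => j _; set x := fun a => p a 0 j - c 0 j.
have E a b : (p a - p b) 0 j ^+ 2 = x a ^+ 2 + x b ^+ 2 - 2 * (x a * x b).
  by rewrite !mxE /x; ring.
under eq_bigr => a _ do under eq_bigr => b _ do rewrite E.
have -> : \sum_(a in A) \sum_(b in A) (x a ^+ 2 + x b ^+ 2 - 2 * (x a * x b)) =
    2 * #|A|%:R * (\sum_(a in A) x a ^+ 2) - 2 * (\sum_(a in A) x a) ^+ 2.
  under eq_bigr => a _ do rewrite sumrB big_split /= sumr_const -mulr_sumr
    -mulr_sumr.
  rewrite sumrB big_split /= sumr_const -mulr_sumr -mulr_suml sumrMnl.
  rewrite -[X in _ - 2 * X]expr2; rewrite -mulr_natl; ring.
rewrite [in leRHS](eq_bigr (fun a => x a ^+ 2)) => [|a _]; last by rewrite !mxE.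
by rewrite gerBl mulr_ge0 // sqr_ge0.
Qed.

Section Cover.
Variables (n d : nat) (B : 'I_n -> {set 'I_d}).

Definition cover_by (T : {set 'I_n}) : {set 'I_d} := \bigcup_(v in T) B v.

Section Distance.
Variables (U : {set 'I_n}) (l Q z : nat).
Hypothesis Bl : forall v, v \in U -> #|B v| = l.
Hypothesis BI : forall u v, u \in U -> v \in U -> u != v ->
  (Q * #|B u :&: B v| <= l)%N.

(** Each [v] in [T :\: T'] keeps a private part of [B v], met by no other vertex of the two edges;
    at most 2 z intersections of size l / Q are lost. Private parts are disjoint and lie in the
    difference of the unions. [U] leaves out isolated vertices, whose codewords are not
    controlled. *)
Lemma card_cover_diff (T T' : {set 'I_n}) : T \subset U -> T' \subset U ->
  (#|T| <= z)%N -> (#|T'| <= z)%N ->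
  (Q * l * #|T :\: T'| <=
   Q * #|cover_by T :\: cover_by T'| + 2 * z * l * #|T :\: T'|)%N.
Proof.
move=> TU TU' Tz Tz'.
pose O v := (T :|: T') :\ v.
pose priv v := B v :\: \bigcup_(u in O v) B u.
have OU v u : u \in O v -> u \in U.
  rewrite !inE => /andP[_ /orP[]]; exact: (fintype.subsetP _ _).
have h v : v \in T :\: T' -> (Q * l <= Q * #|priv v| + 2 * z * l)%N.
  rewrite inE => /andP[vT' vT]; have vU := fintype.subsetP TU v vT.
  rewrite -[X in (Q * X <= _)%N](Bl vU) -(cardsID (\bigcup_(u in O v) B u) (B
    v)) mulnDr addnC leq_add2l.
  rewrite big_distrr /=.
  apply: leq_trans (leq_mul (leqnn Q) (card_bigcup_le _ _)) _.
  rewrite big_distrr /=; apply: (@leq_trans (\sum_(u in O v) l)).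
    apply: leq_sum => u uO; apply: BI => //; first exact: OU uO.
    by move: uO; rewrite !inE eq_sym => /andP[].
  rewrite sum_nat_const leq_mul2r; apply/orP; right.
  apply: leq_trans (subset_leq_card (finset.subD1set _ _)) _.
  apply: leq_trans (leq_card_setU _ _) _; rewrite mul2n -addnn; exact: leq_add.
have disj : (\sum_(v in T :\: T') #|priv v| <= #|cover_by T :\: cover_by T'|)%N.
  rewrite card_sum_mem (eq_bigr _ (fun v _ =>
    card_sum_mem (priv v))) exchange_big.
  apply: leq_sum => i _ /=.
  have [/existsP[v /andP[vTT iv]]|no] :=
    boolP [exists v in T :\: T', i \in priv v];
    last first.
    rewrite big1 // => v vTT; case: (boolP (i \in _)) => // iv.
    by case/existsP: no; exists v; rewrite vTT.
  rewrite (bigD1 v) //= big1 => [|u /andP[uTT uv]]; last first.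
    case: (boolP (i \in _)) => //; rewrite inE => /andP[/bigcupP[]].
    exists v; last by move: iv; rewrite inE => /andP[].
    by move: vTT; rewrite !inE eq_sym uv => /andP[_ ->].
  rewrite iv addn0; suff -> : i \in cover_by T :\: cover_by T' by [].
  move: iv vTT; rewrite !finset.in_setD => /andP[iO iB] /andP[vT' vT].
  apply/andP; split; last by apply/bigcupP; exists v.
  apply: contra iO => /bigcupP[u uT' iu]; apply/bigcupP; exists u => //.
  by rewrite !inE uT' orbT andbT; apply: contraNneq vT' => <-.
have : (\sum_(v in T :\: T') Q * l <= \sum_(v in T :\: T') (Q * #|priv v| + 2 *
  z * l))%N.
  exact: leq_sum.
rewrite big_split /= !sum_nat_const -big_distrr /= => h1.
rewrite mulnC [(2 * z * l * _)%N]mulnC; apply: leq_trans h1 _.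
by rewrite leq_add2r leq_mul2l disj orbT.
Qed.

Hypothesis l_gt0 : (0 < l)%N.
Hypothesis Qz : (2 * z < Q)%N.

(** Equal unions leave only the loss term in [card_cover_diff], and 2 z < Q then forces [T :\: T']
    to be empty. *)
Lemma cover_by_inj (T T' : {set 'I_n}) : T \subset U -> T' \subset U ->
  #|T| = z -> #|T'| = z -> cover_by T = cover_by T' -> T = T'.
Proof.
move=> TU TU' Tz Tz' E; have := card_cover_diff TU TU';
  rewrite Tz Tz' => /(_ (leqnn _) (leqnn _)).
rewrite E finset.setDv cards0 muln0 add0n leq_mul2r leq_pmul2r // leqNgt Qz orbF
  cards_eq0 finset.setD_eq0.
by move=> TT'; apply/eqP; rewrite eqEcard TT' Tz Tz' /=.
Qed.
End Distance.

Lemma card_cover_diff_le (l : nat) (S T : {set 'I_n}) :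
  (forall v, v \in T -> #|B v| <= l)%N -> S \subset T ->
  (#|cover_by T :\: cover_by S| + #|cover_by S :\: cover_by T| <=
    (#|T| - #|S|) * l)%N.
Proof.
move=> Bl ST.
have -> : #|cover_by S :\: cover_by T| = 0%N.
  apply/eqP; rewrite cards_eq0 finset.setD_eq0; apply/bigcupsP => v vS.
  by apply: finset.bigcup_sup; exact: (fintype.subsetP ST).
rewrite addn0 -[in leqRHS](finset.setIidPr ST) -cardsD.
apply: (@leq_trans #|\bigcup_(v in T :\: S) B v|).
  apply: subset_leq_card; apply/fintype.subsetP => i;
    rewrite inE => /andP[iS /bigcupP[v vT iv]].
  apply/bigcupP; exists v => //; rewrite inE vT andbT.
  by apply: contraNN iS => vS; apply/bigcupP; exists v.
apply: leq_trans (card_bigcup_le _ _) _; rewrite -sum_nat_const.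
by apply: leq_sum => v; rewrite inE => /andP[_ /Bl].
Qed.
End Cover.

Lemma indicator_inj d : injective (@indicator d).
Proof.
move=> X Y E; apply/finset.setP => i.
by have := congr1 (fun t => tnth t i) E; rewrite !tnth_mktuple.
Qed.

Lemma card_symdiff (R : realType) n z (X Y : {set 'I_n}) : #|X| = z ->
  #|Y| = z ->
  (#|X :\: Y| + #|Y :\: X|)%:R = 2 * z%:R - 2 * #|X :&: Y|%:R :> R.
Proof.
move=> Xz Yz; have := cardsID Y X; have := cardsID X Y.
rewrite finset.setIC Xz Yz => /(congr1 (fun x => x%:R :
  R)) h1 /(congr1 (fun x => x%:R : R)).
rewrite natrD in h1; rewrite !natrD; move: h1; lra.
Qed.

(** * Real forms of the counting bounds *)

Section Arithmetic.
Variable R : realType.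

Lemma scaled_distance_le (Q l a b z : nat) : (0 < Q)%N ->
  (Q * l * a <= Q * b + 2 * z * l * a)%N ->
  (1 - (2 * z)%:R / Q%:R) * l%:R * a%:R <= b%:R :> R.
Proof.
rewrite -(ltr0n R) -(ler_nat R) natrD !natrM => Q0 h.
rewrite -(ler_pM2l Q0) -subr_ge0; move: h; rewrite -subr_ge0; congr (0 <= _).
by field; rewrite gt_eqF.
Qed.

Lemma cluster_bound_real (K m J y M z e f : nat) : (0 < K)%N ->
  (K * J + K * (m * m) <= m * (K * (y * m) + K * M + z * m + K * (e * f)))%N ->
  J%:R <= m%:R * ((y%:R - 1 + z%:R / K%:R) * m%:R + M%:R + e%:R * f%:R) :> R.
Proof.
rewrite -(ltr0n R) -(ler_nat R) !natrD !natrM !natrD !natrM => K0 h.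
rewrite -(ler_pM2l K0) -subr_ge0; move: h; rewrite -subr_ge0; congr (0 <= _).
by field; rewrite gt_eqF.
Qed.

(** [a] is the scale of the distances, [W] the cost of a cluster of [m] edges, [J] the sum of
    pairwise intersections, [e] the error from bad edges. The last two hypotheses are the averaging
    bound and [cluster_bound]. *)
Lemma cluster_cost_ge (a m z y zK J M e W : R) : 0 < m -> 0 <= a ->
  a * (2 * (z * m ^+ 2 - J)) <= 2 * m * W ->
  J <= m * ((y - 1 + zK) * m + M + e) ->
  a * ((z - y + 1 - zK) * m - M - e) <= W.
Proof.
move=> m0 a0 h1 h2; rewrite -(ler_pM2l m0).
suff : a * (m * ((z - y + 1 - zK) * m - M - e)) <= a * (z * m ^+ 2 - J).
  move=> h3; rewrite mulrCA; apply: le_trans h3 _; move: h1.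
  by rewrite mulrCA -mulrA ler_pM2l.
rewrite ler_wpM2l // -subr_ge0; move: h2; rewrite -subr_ge0; congr (0 <= _).
ring.
Qed.

Lemma double_natmul (z J : R) (m : nat) :
  2 * (z * m%:R ^+ 2 - J) = 2 * z *+ m *+ m - 2 * J.
Proof. by rewrite -(mulr_natr (2 * z *+ m)) -(mulr_natr (2 * z)); ring. Qed.

Lemma total_cost_ge (c a q e S P : R) : S <= a * e ->
  (c - a - q) * e - P <= (c - q) * e - S - P.
Proof. lra. Qed.

End Arithmetic.

(** * Clustering cost of the points of a hypergraph *)

Section Instance.
Variables (R : realType) (n d z y l Q : nat) (E : {set {set 'I_n}}).
Variable B : 'I_n -> {set 'I_d}.
Hypothesis y_gt0 : (0 < y)%N.
Hypothesis yz : (y < z)%N.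
Hypothesis E_neq0 : E != finset.set0.
Hypothesis cardE : forall T, T \in E -> #|T| = z.
Hypothesis Bl : forall v, v \in finset.cover E -> #|B v| = l.
Hypothesis BI : forall u v, u \in finset.cover E -> v \in finset.cover E ->
  u != v -> (Q * #|B u :&: B v| <= l)%N.
Hypothesis l_gt0 : (0 < l)%N.
Hypothesis Qz : (2 * z < Q)%N.

Definition edge_point (T : {set 'I_n}) : d.-tuple bool :=
  indicator (cover_by B T).
Definition edge_points : {set d.-tuple bool} := [set edge_point T | T in E].

Let E_cover (T : {set 'I_n}) : T \in E -> T \subset finset.cover E.
Proof. by move=> TE; rewrite /finset.cover; apply: finset.bigcup_sup TE. Qed.

Lemma edge_point_inj : {in E &, injective edge_point}.
Proof.
move=> T T' TE TE' /indicator_inj.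
by apply: (cover_by_inj Bl BI l_gt0 Qz); rewrite ?E_cover ?cardE.
Qed.

Lemma card_edge_points : #|edge_points| = #|E|.
Proof. by rewrite card_in_imset //; exact: edge_point_inj. Qed.

Lemma kmeans_cost_edges k (c : 'I_k -> 'rV[R]_d) (sigma : d.-tuple bool ->
  'I_k) :
  kmeans_cost edge_points c sigma = \sum_(T in E)
    sq_l2norm (point_vector R (edge_point T) - c (sigma (edge_point T))).
Proof. by rewrite /kmeans_cost big_imset //; exact: edge_point_inj. Qed.

Lemma edge_points_complete k : (0 < k)%N -> johnson_complete y E k ->
  exists (c : 'I_k -> 'rV[R]_d) (sigma : d.-tuple bool -> 'I_k),
    kmeans_cost edge_points c sigma <= (#|E| * ((z - y) * l))%:R.
Proof.
move=> k0 [S [Sy SE]].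
pose c i := point_vector R (indicator (cover_by B (S i))).
(* Injectivity recovers the edge from its point, so the default index is never taken on a point of
   the set. *)
pose sigma (a : d.-tuple bool) : 'I_k := odflt (Ordinal k0)
  [pick i | [exists T in E, (a == edge_point T) && (S i \subset T)]].
exists c, sigma; rewrite kmeans_cost_edges natrM mulr_natl -sumr_const.
apply: ler_sum => T TE; rewrite /sigma; case: pickP => [i|no] /=.
  case/existsP => T' /and3P[TE' /eqP /(edge_point_inj TE TE') <- ST].
  rewrite /c sq_l2norm_indicator ler_nat -[z](cardE TE) -(Sy i).
  apply: card_cover_diff_le => // v vT.
  by rewrite Bl // (fintype.subsetP (E_cover TE)).
have [i ST] := SE T TE; have := no i; move/negbT/existsPn/(_ T).
by rewrite TE eqxx ST.
Qed.

Lemma exists_card_set : exists S : {set 'I_n}, #|S| = y.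
Proof.
have [T TE] := finset.set0Pn _ E_neq0; have Tz := cardE TE.
have : (0 < #|[set X : {set 'I_n} | X \subset T & #|X| == y]|)%N.
  by rewrite cards_draws bin_gt0 Tz ltnW.
by case/card_gt0P => X; rewrite inE => /andP[_ /eqP]; exists X.
Qed.

(** In each cluster [S i] is a [y]-set contained in the most edges, which supplies the [M] of
    [cluster_bound]. Edges counted in different clusters are distinct and all covered by the family
    [S], so these values sum to at most [alpha * #|E|]. The error is paid once per cluster, hence
    the factor [k]. *)
Lemma edge_points_sound k (alpha : R) K : (0 < K)%N ->
  johnson_sound alpha y E k ->
  forall (c : 'I_k -> 'rV[R]_d) (sigma : d.-tuple bool -> 'I_k),
  (1 - (2 * z)%:R / Q%:R) * l%:R *
    (((z - y).+1%:R - alpha - z%:R / K%:R) * #|E|%:R -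
     (z.+1 * 2 ^ (z * K))%:R * (k%:R * n%:R ^+ (z - y - 1)))
  <= kmeans_cost edge_points c sigma.
Proof.
move=> K0 sE c sigma; set lam := 1 - _.
have Q0 : 0 < Q%:R :> R by rewrite ltr0n; lia.
have lam0 : 0 <= lam.
  by rewrite subr_ge0 ler_pdivrMr // mul1r ler_nat ltnW.
pose A (i : 'I_k) := [set T in E | sigma (edge_point T) == i].
have AE i T : T \in A i -> T \in E by rewrite inE => /andP[].
pose cont (F : {set {set 'I_n}}) (X : {set 'I_n}) :=
  #|[set T in F | X \subset T]|.
have [S0 S0y] := exists_card_set.
pose S (i : 'I_k) : {set 'I_n} := [arg max_(X > S0 | #|X| == y) cont (A i) X].
have Sy i : #|S i| = y.
  by rewrite /S; case: arg_maxnP => [|X /eqP //]; rewrite S0y.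
have Smax i (X : {set 'I_n}) : #|X| = y -> (cont (A i) X <= cont (A i) (S i))%N.
  move=> Xy; rewrite /S; case: arg_maxnP => [|X' _]; first by rewrite S0y.
  by apply; rewrite Xy.
set err := (z.+1 * 2 ^ (z * K))%:R * n%:R ^+ (z - y - 1) : R.
have clusterP i : lam * l%:R * (((z - y).+1%:R - z%:R / K%:R) * #|A i|%:R
    - (cont (A i) (S i))%:R - err) <=
  \sum_(T in A i) sq_l2norm (point_vector R (edge_point T) - c i).
  (* An empty cluster escapes the averaging bound, but its left side is at most 0. *)
  have [A0|A0] := posnP #|A i|.
    have -> : A i = finset.set0 by apply: cards0_eq.
    rewrite big_set0 mulr_ge0_le0 ?mulr_ge0 // cards0 mulr0 sub0r -opprD
      oppr_le0.
    by rewrite addr_ge0 ?mulr_ge0 ?exprn_ge0.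
  have /= bnd := @cluster_bound n z y (A i) y_gt0 yz (fun T TA =>
    cardE (AE i T TA)) K K0 A0 _ (Smax i).
  have ax := sum_sq_l2norm (A i) (fun T => point_vector R (edge_point T)) (c i).
  set W := \sum_(T in A i) sq_l2norm _ in ax *.
  set J := (\sum_(T in A i) \sum_(T' in A i) #|T :&: T'|)%N in bnd.
  have dist : lam * l%:R * (2 * (z%:R * #|A i|%:R ^+ 2 - J%:R)) <=
      \sum_(T in A i) \sum_(T' in A i) sq_l2norm
        (point_vector R (edge_point T) - point_vector R (edge_point T')).
    have -> : 2 * (z%:R * #|A i|%:R ^+ 2 - J%:R) =
        \sum_(T in A i) \sum_(T' in A i) (#|T :\: T'| + #|T' :\: T|)%:R :> R.
      rewrite (eq_bigr (fun T => \sum_(T' in A i) (2 * z%:R - 2 * #|T :&: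
        T'|%:R))); last first.
        by move=> T TA; apply: eq_bigr => T' TA';
          rewrite (card_symdiff _ (cardE (AE i T TA)) (cardE (AE i T' TA'))).
      under eq_bigr => T _ do rewrite sumrB sumr_const -mulr_sumr -natr_sum.
      rewrite sumrB sumr_const -mulr_sumr -natr_sum -/J; exact: double_natmul.
    rewrite mulr_sumr; apply: ler_sum => T TA; rewrite mulr_sumr;
      apply: ler_sum => T' TA'.
    rewrite sq_l2norm_indicator.
    have half (X Y : {set 'I_n}) : X \in A i -> Y \in A i ->
        lam * l%:R * #|X :\: Y|%:R <= #|cover_by B X :\: cover_by B Y|%:R.
      move=> XA YA; have := card_cover_diff Bl BI (E_cover (AE i X XA)) (E_cover
        (AE i Y YA)).
      rewrite (cardE (AE i X XA)) (cardE (AE i Y YA)) =>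
        /(_ z (leqnn _) (leqnn _)).
      by apply: scaled_distance_le; rewrite -(ltr0n R).
    by rewrite !natrD mulrDr lerD ?half.
  have m0 : 0 < #|A i|%:R :> R by rewrite ltr0n.
  have K0' : 0 < K%:R :> R by rewrite ltr0n.
  have bnd' : J%:R <= #|A i|%:R * ((y%:R - 1 + z%:R / K%:R) * #|A i|%:R +
      (cont (A i) (S i))%:R + err).
    rewrite (mulnA z.+1) in bnd; have := cluster_bound_real R K0 bnd;
      rewrite natrX; exact.
  rewrite -addn1 natrD natrB ?(ltnW yz) //.
  by apply: cluster_cost_ge (le_trans dist ax) bnd' => //; exact: mulr_ge0.
have -> : kmeans_cost edge_points c sigma =
    \sum_i \sum_(T in A i) sq_l2norm (point_vector R (edge_point T) - c i).
  rewrite kmeans_cost_edges (partition_big (fun T =>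
    sigma (edge_point T)) xpredT) //=.
  apply: eq_bigr => i _; apply: eq_big => [T|T /andP[_ /eqP ->]] //.
  by rewrite inE.
apply: le_trans (ler_sum _ (fun i _ => clusterP i)).
rewrite -mulr_sumr ler_wpM2l ?mulr_ge0 // !sumrB -mulr_sumr sumr_const card_ord.
have -> : \sum_(i < k) #|A i|%:R = #|E|%:R :> R.
  rewrite -natr_sum; congr _%:R; rewrite -[RHS]sum1_card.
  rewrite (partition_big (fun T => sigma (edge_point T)) xpredT) //=.
  apply: eq_bigr => i _; rewrite -sum1_card.
  by apply: eq_bigl => T; rewrite inE.
have covE : \sum_(i < k) (cont (A i) (S i))%:R <= alpha * #|E|%:R.
  apply: le_trans (sE S Sy); rewrite -natr_sum ler_nat.
  rewrite -[leqRHS]sum1_card (partition_big (fun T =>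
    sigma (edge_point T)) xpredT) //=.
  apply: leq_sum => i _; rewrite /cont -sum1_card [leqLHS]big_mkcond
    [leqRHS]big_mkcond.
  apply: leq_sum => T _; rewrite !inE.
  case: (boolP (_ && (S i \subset T))) => // /andP[/andP[-> ->] ST] /=.
  by rewrite (introT existsP) //; exists i.
rewrite (_ : (z.+1 * 2 ^ (z * K))%:R * (k%:R * n%:R ^+ (z - y - 1)) = err *+ k);
  last first.
  by rewrite mulrCA mulr_natl.
exact: total_cost_ge.
Qed.

End Instance.

(** * Correctness of the reduction *)

Local Open Scope nat_scope.

Lemma size_char_vector n (T : {set 'I_n}) : size (char_vector T) = n.
Proof. by rewrite size_map size_enum_ord. Qed.

Lemma nth_char_vector n (T : {set 'I_n}) (v : 'I_n) :
  nth false (char_vector T) v = (v \in T).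
Proof. by rewrite (nth_map v) ?size_enum_ord // nth_ord_enum. Qed.

Lemma char_vector_inj n : injective (@char_vector n).
Proof.
by move=> T T' E; apply/finset.setP => v; rewrite -!nth_char_vector E.
Qed.

Lemma has_iota_ord n (f : nat -> bool) : has f (iota 0 n) = [exists v :
  'I_n, f v].
Proof.
apply/hasP/existsP => [[v]|[v fv]].
  by rewrite mem_iota add0n => /= vn fv; exists (Ordinal vn).
by exists (val v) => //; rewrite mem_iota add0n /=.
Qed.

Lemma count_iota_ord n (f : nat -> bool) : count f (iota 0 n) = #|[set v :
  'I_n | f v]|.
Proof.
rewrite -sum1_count -[n in iota 0 n]subn0 -/(index_iota 0 n) big_mkord
  -sum1_card.
by apply: eq_bigl => v; rewrite inE.
Qed.

Section Link.
Variables (z n Q : nat) (E : {set {set 'I_n}}) (l : seq {set 'I_n}).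
Hypothesis z_gt0 : 0 < z.
Hypothesis lE : perm_eq l (enum E).
Hypothesis cardE : forall T, T \in E -> #|T| = z.
Hypothesis E_gt1 : 1 < #|E|.

Let q := 8 ^ Q.
Let qQ : q = 8 ^ Q. Proof. by []. Qed.
Let C := z.+2.
Let rows := [seq char_vector T | T <- l].
Let L := log_word C rows.

Definition code_set (v : 'I_n) : {set 'I_(q * size L)%N} :=
  [set i : 'I_(q * size L) | nth false (codeword q C Q rows v) i].

Let mem_l T : (T \in l) = (T \in E).
Proof. by rewrite (perm_mem lE) mem_enum. Qed.

Let size_rows : size rows = #|E|.
Proof. by rewrite size_map (perm_size lE) -fintype.cardE. Qed.

Lemma size_log_rows : size L = C * trunc_log 2 #|E|.
Proof. by rewrite log_wordP size_rows // ltnW. Qed.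

Lemma used_cover (v : 'I_n) : used rows v = (v \in finset.cover E).
Proof.
rewrite /used has_map /finset.cover; apply/hasP/bigcupP => -[T].
  by rewrite mem_l /= nth_char_vector; exists T.
by exists T; rewrite ?mem_l //= nth_char_vector.
Qed.

Lemma log_rows_gt0 : 0 < size L.
Proof. by rewrite size_log_rows muln_gt0 /= trunc_log_gt0. Qed.

(** This is where [C = z.+2] comes from. With j = floor(log2 |E|) >= 1 there are at most z 2^(j+1)
    used vertices, and [4 ^ size L] is the product of 4^(z j) and 4^(2 j), which dominate z and
    2^(j+1) respectively. *)
Lemma used_le : count (used rows) (iota 0 n) <= 4 ^ size L.
Proof.
rewrite count_iota_ord.
have -> : [set v : 'I_n | used rows v] = finset.cover E.
  by apply/finset.setP => v; rewrite inE used_cover.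
apply: leq_trans (card_bigcup_le _ _) _.
rewrite (eq_bigr (fun=> z)) // sum_nat_const size_log_rows.
have /andP[_] := @trunc_log_bounds 2 #|E| isT (ltnW E_gt1).
have : 0 < trunc_log 2 #|E| by rewrite trunc_log_gt0.
case: (trunc_log _ _) => // j _ mj.
apply: leq_trans (leq_mul (ltnW mj) (leqnn z)) _.
have -> : C * j.+1 = z * j.+1 + 2 * j.+1 by rewrite -mulnDl addn2.
rewrite expnD mulnC leq_mul //.
  apply: (@leq_trans (2 ^ z)); first by rewrite ltnW // ltn_expl.
  apply: (@leq_trans (4 ^ z)); first by case: (z) => // z'; rewrite leq_exp2r.
  by rewrite leq_exp2l // leq_pmulr.
rewrite (_ : 4 = 2 ^ 2) // -expnM leq_exp2l //; lia.
Qed.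

Lemma card_code_set v : v \in finset.cover E -> #|code_set v| = size L.
Proof.
rewrite -used_cover => uv.
apply: etrans (code_weight qQ used_le (ltn_ord v) uv).
rewrite overlapE (size_code qQ used_le (ltn_ord v) uv) card_sum_mem.
 apply: eq_bigr => i _.
by rewrite inE andbb.
Qed.

Lemma card_code_setI u v : u \in finset.cover E -> v \in finset.cover E ->
  u != v -> Q * #|code_set u :&: code_set v| <= size L.
Proof.
rewrite -!used_cover.
wlog uv : u v / u < v.
  move=> W uu vv nuv; have [uv|vu|E'] := ltngtP u v; first exact: W.
    by rewrite finset.setIC; apply: W => //; rewrite eq_sym.
  by rewrite (val_inj E') eqxx in nuv.
move=> uu vv _; have := code_overlap qQ used_le uv (ltn_ord v) uu vv.
rewrite overlapE (size_code qQ used_le (ltn_ord v) vv) => /ltnW.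
congr (_ <= _); congr (_ * _); rewrite card_sum_mem; apply: eq_bigr => i _.
by rewrite !inE.
Qed.

Lemma point_edge T : T \in E -> tval (edge_point code_set T) =
  row_point q C Q rows n (char_vector T).
Proof.
move=> TE; have Tr : char_vector T \in rows by apply: map_f; rewrite mem_l.
have hT : has (nth false (char_vector T)) (iota 0 n).
  rewrite has_iota_ord; have /card_gt0P[v vT] : 0 < #|T| by rewrite cardE.
  by apply/existsP; exists v; rewrite nth_char_vector.
have sz := size_row_point qQ used_le Tr hT.
apply: (@eq_from_nth _ false); first by rewrite size_tuple sz.
move=> i; rewrite size_tuple => id.
rewrite (nth_row_point qQ used_le Tr id) has_iota_ord.
rewrite -[i in LHS]/(val (Ordinal id)) nth_mktuple.
apply/bigcupP/existsP => -[v].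
  by move=> vT; rewrite inE => iv; exists v; rewrite nth_char_vector vT.
by rewrite nth_char_vector => /andP[vT iv]; exists v => //; rewrite inE.
Qed.

Hypothesis Qz : 2 * z < Q.

Lemma point_rows_edges : point_rows q C Q rows =
  [seq tval a | a <- [seq edge_point code_set T | T <- l]].
Proof.
rewrite point_rowsE -!map_comp; apply/eq_in_map => T /=; rewrite mem_l => TE.
rewrite (point_edge TE); congr row_point.
case El: l => [|T' l'] /=; last by rewrite /rows El /= size_char_vector.
by move: E_gt1; rewrite -size_rows size_map El.
Qed.

Lemma perm_edge_points :
  perm_eq [seq edge_point code_set T | T <- l] (enum (edge_points E code_set)).
Proof.
apply: uniq_perm; [|exact: enum_uniq|].
  rewrite map_inj_in_uniq ?(perm_uniq lE) ?enum_uniq // => T T'.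
  rewrite !mem_l; exact: (edge_point_inj cardE card_code_set card_code_setI
    log_rows_gt0 Qz).
move=> a; rewrite mem_enum; apply/mapP/imsetP => -[T TE ->].
  by exists T; rewrite // -mem_l.
by exists T; rewrite // mem_l.
Qed.

Lemma encodes_edge_points k :
  encodes_points (edge_points E code_set) k (encode k (point_rows q C Q rows)).
Proof.
exists [seq edge_point code_set T | T <- l]; split;
  first exact: perm_edge_points.
by rewrite point_rows_edges.
Qed.

End Link.

Local Open Scope ring_scope.

(** * Unambiguous encodings and small universes *)

Lemma delimit_cat_inj x x' y y' : delimit x ++ y = delimit x' ++ y' ->
  x = x' /\ y = y'.
Proof. by move/(congr1 undelimit); rewrite !undelimitK => -[-> ->]. Qed.

Lemma flatten_delimit_inj (s s' : seq bitseq) :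
  flatten [seq delimit r | r <- s] = flatten [seq delimit r | r <- s'] ->
    s = s'.
Proof.
elim: s s' => [|r s IH] [|r' s'] //=.
- by move/esym/delimit_neq0.
- by move/delimit_neq0.
- by case/delimit_cat_inj => -> /IH ->.
Qed.

Lemma encode_inj k k' rows rows' : encode k rows = encode k' rows' ->
  k = k' /\ rows = rows'.
Proof.
case/delimit_cat_inj => /(congr1 size); rewrite !size_nseq => ->
  /flatten_delimit_inj ->.
by [].
Qed.

Section Johnson.
Variables (R : realType) (h : nat -> R) (alpha : R) (z y : nat).
Hypothesis alpha_lt1 : alpha < 1.
Hypothesis yz : (y < z)%N.

Lemma complete_not_sound n (E : {set {set 'I_n}}) k : E != finset.set0 ->
  johnson_complete y E k -> ~ johnson_sound alpha y E k.
Proof.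
move=> E0 [S [Sy SE]] /(_ S Sy).
have -> : [set T in E | [exists i, S i \subset T]] = E.
  apply/finset.setP => T; rewrite inE; case: (boolP (T \in E)) => //= /SE[i ST].
  by apply/existsP; exists i.
have E1 : 0 < #|E|%:R :> R by rewrite ltr0n card_gt0.
by rewrite -[leLHS]mul1r ler_pM2r // leNgt alpha_lt1.
Qed.

(** The word determines [k], [n] and [E]: [n] is the length of any row, and a row exists because [E]
    is nonempty. The hard-coded answers rely on this. *)
Lemma yes_not_no w : yes_instance (johnson_coverage_star h alpha z y) w ->
  ~ no_instance (johnson_coverage_star h alpha z y) w.
Proof.
move=> [n [E [k [[l [lE ->]] [[_ E0 _] _] cE]]]].
move=> [n' [E' [k' [[l' [lE' /encode_inj[kk rr]]] _ sE']]]].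
have nn : n = n'.
  case: l lE rr => [|T l] lE.
    by case/finset.set0Pn: E0 => T; rewrite -mem_enum -(perm_mem lE).
  case: l' lE' => //= T' l' _ [/(congr1 size)].
  by rewrite !size_char_vector.
subst n' k'; have ll : l = l' := inj_map (@char_vector_inj n) rr.
have EE : E = E'.
  by apply/finset.setP => T; rewrite -mem_enum -[RHS]mem_enum -(perm_mem lE)
    -(perm_mem lE') ll.
by subst E'; exact: complete_not_sound cE sE'.
Qed.

(** With [k >= #|E|], one [y]-subset per edge would cover everything. This controls the parameter of
    negative instances, which [n] alone does not. *)
Lemma sound_k_lt n (E : {set {set 'I_n}}) k : johnson_instance z E k ->
  johnson_sound alpha y E k -> (k < #|E|)%N.
Proof.
move=> [k0 E0 cE] sE; rewrite ltnNge; apply/negP => Ek.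
apply: complete_not_sound sE => //.
have pickS (T : {set 'I_n}) : exists S : {set 'I_n}, T \in E ->
  #|S| = y /\ S \subset T.
  have [TE|TE] := boolP (T \in E); last by exists T.
  have : (0 < #|[set X : {set 'I_n} | X \subset T & #|X| == y]|)%N.
    by rewrite cards_draws bin_gt0 cE // ltnW.
  by case/card_gt0P => X; rewrite inE => /andP[XT /eqP]; exists X.
have [S SP] := choice pickS.
have [T0 T0E] := finset.set0Pn _ E0.
(* Indices beyond [#|E|] fall back on [T0], so that all [k] sets have size [y]. *)
exists (fun i => S (nth T0 (enum E) i)) ; split.
  move=> i; suff : nth T0 (enum E) i \in E by move/SP => [].
  have [iE|iE] := ltnP i (size (enum E)); last by rewrite nth_default.
  by rewrite -mem_enum mem_nth.
move=> T TE; have iE : (index T (enum E) < k)%N.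
  by apply: leq_trans Ek; rewrite fintype.cardE index_mem mem_enum.
by exists (Ordinal iE); rewrite /= nth_index ?mem_enum //; case: (SP T TE).
Qed.

Lemma size_encode k rows n : all (fun r => size r == n) rows ->
  size (encode k rows) = (k.*2.+1 + size rows * n.*2.+1)%N.
Proof.
rewrite /encode size_cat size_delimit size_nseq => rn; congr (_ + _)%N.
by elim: rows rn => //= r s IH /andP[/eqP rn /IH E];
  rewrite size_cat size_delimit E rn mulSn.
Qed.

(** Fewer than [n0] vertices carry at most [2 ^ n0] edges, and [k] is smaller than their number.
    Positive instances call for no such bound: the reduction is correct on them for every
    universe. *)
Lemma no_instance_size n0 n (E : {set {set 'I_n}}) k w :
  encodes_hypergraph E k w -> johnson_instance z E k ->
    johnson_sound alpha y E k ->
  (n < n0)%N -> (size w <= 2 ^ n0 * (2 * n0 + 4))%N.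
Proof.
move=> [l [lE ->]] iE sE nn0; have kE := sound_k_lt iE sE.
have En : (#|E| <= 2 ^ n0)%N.
  apply: leq_trans (max_card _) _.
  by rewrite -cardsT -finset.powersetT card_powerset cardsT card_ord leq_exp2l
    // ltnW.
rewrite (@size_encode _ _ n); last by apply/allP => _ /mapP[T _ ->];
  rewrite size_char_vector.
rewrite size_map (perm_size lE) -fintype.cardE.
have E1 : (0 < #|E|)%N by lia.
apply: (@leq_trans (#|E| * (2 * n0 + 4))); last by rewrite leq_mul2r En orbT.
have -> : (2 * n0 + 4 = 3 + (2 * n0 + 1))%N by lia.
rewrite mulnDr leq_add //; first by lia.
by rewrite leq_mul2l; apply/orP; right; lia.
Qed.

End Johnson.

Definition words_upto (N : nat) : seq bitseq :=
  flatten [seq [seq tval t | t <- enum {: n.-tuple bool}] | n <- iota 0 N.+1].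

Lemma mem_words_upto N w : (w \in words_upto N) = (size w <= N)%N.
Proof.
apply/flattenP/idP => [[_ /mapP[n + ->] /mapP[t _ ->]]|wN].
  by rewrite mem_iota size_tuple.
exists [seq tval t | t <- enum {: (size w).-tuple bool}].
  by apply/mapP; exists (size w); rewrite // mem_iota.
by apply/mapP; exists (in_tuple w); rewrite ?mem_enum.
Qed.

(** * Constant k-means instances *)

Section Fixed.
Variables (R : realType) (d : nat).
Hypothesis d_gt0 : (0 < d)%N.

(** These serve as hard-coded answers: two centres cost 0, while one centre costs at least d / 2,
    which a suitable dimension makes as large as desired. *)
Definition two_points : {set d.-tuple bool} :=
  [set indicator finset.set0; indicator [set: 'I_d]].

Lemma card_two_points : #|two_points| = 2%N.
Proof.
rewrite cards2; suff -> : indicator finset.set0 != indicator [set: 'I_d] by [].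
apply/eqP => /indicator_inj /finset.setP /(_ (Ordinal d_gt0)).
by rewrite finset.in_set0 finset.in_setT.
Qed.

Lemma encodes_two_points k : encodes_points two_points k
  (encode k [seq tval a | a <- enum two_points]).
Proof. by exists (enum two_points). Qed.

Lemma two_points_complete (rho : R) : 0 <= rho ->
  kmeans_complete rho two_points 2.
Proof.
move=> r0; pose a0 := indicator (finset.set0 : {set 'I_d}).
exists (fun i => point_vector R (if i == ord0 then a0 else indicator [set:
  'I_d])).
exists (fun a => if a == a0 then ord0 else lift ord0 ord0).
rewrite /kmeans_cost big1; first by rewrite mulr_ge0 // mulr_ge0 // ln_ge0 //
  ler1n card_two_points.
move=> a; rewrite !inE => aP; rewrite /sq_l2norm big1 // => j _.
suff -> : point_vector R (if (if a == a0 then ord0 else lift ord0 ord0) == ord0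
  :> 'I_2
    then a0 else indicator [set: 'I_d]) =
      point_vector R a by rewrite !mxE subrr expr0n.
by congr point_vector; case: eqVneq aP => [->|_] //= /eqP.
Qed.

Lemma two_points_sound (gap rho : R) : gap * (rho * (2 * ln 2)) <= d%:R / 2 ->
  kmeans_sound gap rho two_points 1.
Proof.
move=> gd c sigma; rewrite card_two_points; apply: le_trans gd _.
have := sum_sq_l2norm two_points (@point_vector R d) (c ord0).
rewrite card_two_points; have -> : \sum_(a in two_points) sq_l2norm
  (point_vector R a - c ord0) =
    kmeans_cost two_points c sigma.
  by apply: eq_bigr => a _; rewrite [sigma a]ord1.
have nin : indicator finset.set0 \notin [set indicator [set: 'I_d]].
  have := card_two_points; rewrite cards2 inE; by case: eqP.
rewrite {1}/two_points (big_setU1 _ nin) big_set1 /= /two_points !(big_setU1 _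
  nin) !big_set1 /=.
rewrite !sq_l2norm_indicator !finset.setDv finset.set0D finset.setD0 cards0
  cardsT card_ord.
by rewrite !addn0 add0n; lra.
Qed.
End Fixed.

(** * Numeric estimates *)

Section Numeric.
Variable R : realType.

(** Four losses of order [ep]: the factor [lam] for overlapping codewords, the rounding of the
    logarithm [t] to [j], the light vertices [zK] and the bad edges [P]. Since (1 - ep)^2 (A - 2 ep)
    is at least A - 2 ep (1 + A), the hypothesis on [e] absorbs them all. *)
Lemma gap_arith (e A lam Cl j t m zK P ep : R) : 0 < ep -> ep <= 1 / 2 ->
  1 <= A ->
  2 * ep * (1 + A) <= e -> 0 <= Cl -> 0 <= m -> 1 - ep <= lam -> 1 <= ep * t ->
  t - 1 <= j -> zK <= ep -> P <= ep * m ->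
  (A - e) * (Cl * (t * m)) <= lam * (Cl * j) * ((A - zK) * m - P).
Proof.
move=> ep0 ep1 A1 eA Cl0 m0 lamE tE jt zKe Pe.
have t0 : 0 <= t.
  by rewrite -(pmulr_rge0 _ ep0); apply: le_trans tE.
have j0 : (1 - ep) * t <= j by apply: le_trans jt; rewrite mulrBl mul1r lerB.
have e1 : 0 <= 1 - ep by lra.
apply: (@le_trans _ _ ((1 - ep) * (Cl * ((1 - ep) * t)) * ((A - 2 * ep) * m)));
  last first.
  apply: ler_pM; rewrite ?mulr_ge0 //; first by lra.
    by apply: ler_pM => //; rewrite ?mulr_ge0 // ler_wpM2l.
  have : zK * m <= ep * m by rewrite ler_wpM2r.
  by rewrite !mulrBl; lra.
have -> : (1 - ep) * (Cl * ((1 - ep) * t)) * ((A - 2 * ep) * m) =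
    ((1 - ep) ^+ 2 * (A - 2 * ep)) * (Cl * (t * m)) by ring.
rewrite ler_wpM2r ?mulr_ge0 //.
have -> : (1 - ep) ^+ 2 * (A - 2 * ep) =
  A - 2 * ep * (1 + A) + ep ^+ 2 * (A - 2 * ep) + 4 * ep ^+ 2.
  by ring.
have : 0 <= ep ^+ 2 * (A - 2 * ep) by rewrite mulr_ge0 ?sqr_ge0 //; lra.
have : 0 <= 4 * ep ^+ 2 by rewrite mulr_ge0 ?sqr_ge0.
lra.
Qed.

Lemma ln2_gt0 : 0 < ln 2 :> R.
Proof. by rewrite ln_gt0 // ltr1n. Qed.

Lemma trunc_log_ln (m : nat) : (0 < m)%N ->
  (trunc_log 2 m)%:R <= ln m%:R / ln 2 :> R /\ ln m%:R / ln 2 - 1 <=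
    (trunc_log 2 m)%:R :> R.
Proof.
move=> m0; have /andP[l1 l2] := @trunc_log_bounds 2 m isT m0.
have l20 := ln2_gt0; have m0' : 0 < m%:R :> R by rewrite ltr0n.
split.
  rewrite ler_pdivlMr // mulr_natl -lnXn // ler_ln ?posrE ?exprn_gt0 //.
  by rewrite -natrX ler_nat.
rewrite lerBlDr ler_pdivrMr // natr1 mulr_natl -lnXn //.
by rewrite ler_ln ?posrE ?exprn_gt0 // -natrX ler_nat ltnW.
Qed.

End Numeric.

Lemma enc_pair_inj (p p' : bitseq * seq bitseq) : enc p = enc p' -> p = p'.
Proof.
case: p p' => [a s] [a' s'] /delimit_cat_inj[aa /flatten_delimit_inj ss].
by congr pair.
Qed.

(** * The reduction on a single instance *)

Section ReductionCorrect.
Variables (R : realType) (z y Q : nat) (D : R) (yes : bitseq * seq bitseq).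
Hypothesis y_gt0 : (0 < y)%N.
Hypothesis yz : (y < z)%N.
Hypothesis Qz : (2 * z < Q)%N.
Let q := (8 ^ Q)%N.
Let C := z.+2.
Hypothesis D_ge : (q * C)%:R / ln 2 <= D.
Let rho : R := (z - y)%:R * C%:R / ln 2.

Let z_gt0 : (0 < z)%N. Proof. exact: leq_ltn_trans yz. Qed.

Variables (n k : nat) (E : {set {set 'I_n}}) (l : seq {set 'I_n}).
Hypothesis lE : perm_eq l (enum E).
Hypothesis iE : johnson_instance z E k.
Let rows := [seq char_vector T | T <- l].
Let p := (nseq k true, rows).

Let size_rows : size rows = #|E|.
Proof. by rewrite size_map (perm_size lE) -fintype.cardE. Qed.

Lemma reduction_trivial : (#|E| <= 1)%N -> reduction q C Q yes p = yes.
Proof.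
move=> E1; case: iE => k0 E0 _; rewrite -card_gt0 in E0.
rewrite /reduction /nilp log_wordP size_rows //.
have -> : #|E| = 1%N by apply/eqP; rewrite eqn_leq E1.
by rewrite trunc_log1 muln0.
Qed.

Hypothesis E_gt1 : (1 < #|E|)%N.
Let cE : forall T, T \in E -> #|T| = z. Proof. by case: iE. Qed.
Let P := edge_points E (code_set z Q l).

Let cardP : #|P| = #|E|.
Proof.
exact: (card_edge_points cE (card_code_set Q z_gt0 lE cE E_gt1)
  (card_code_setI Q z_gt0 lE cE E_gt1) (log_rows_gt0 z lE E_gt1) Qz).
Qed.

Let lnE_gt0 : 0 < ln #|E|%:R :> R.
Proof. by rewrite ln_gt0 // ltr1n. Qed.

Lemma reduction_encodes : encodes_points P k (enc (reduction q C Q yes p)).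
Proof.
have := log_rows_gt0 z lE E_gt1; rewrite /reduction lt0n => /negbTE /= L0.
rewrite [nilp _]L0.
exact: (encodes_edge_points z_gt0 lE cE E_gt1 Qz).
Qed.

Lemma reduction_instance : kmeans_instance D P k.
Proof.
case: iE => k0 _ _; split=> //; rewrite cardP //.
rewrite (size_log_rows z lE E_gt1) mulnA natrM.
have [t1 _] := @trunc_log_ln R #|E| (ltnW E_gt1).
apply: (@le_trans _ _ ((q * C)%:R / ln 2 * ln #|E|%:R)).
  by rewrite -mulrA [_^-1 * _]mulrC ler_wpM2l.
by rewrite ler_wpM2r // ltW.
Qed.

Lemma reduction_complete : johnson_complete y E k -> kmeans_complete rho P k.
Proof.
case: iE => k0 E0 _ /(edge_points_complete R cE (card_code_set Q z_gt0 lE cE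
  E_gt1)
  (card_code_setI Q z_gt0 lE cE E_gt1) (log_rows_gt0 z lE E_gt1) Qz k0) [c
    [sigma cs]].
exists c, sigma; apply: le_trans cs _; rewrite cardP (size_log_rows z lE E_gt1).
have [t1 _] := @trunc_log_ln R #|E| (ltnW E_gt1).
have -> : rho * (#|E|%:R * ln #|E|%:R) =
    #|E|%:R * ((z - y)%:R * (C%:R * (ln #|E|%:R / ln 2))).
  by rewrite /rho; field; rewrite gt_eqF // ln2_gt0.
by rewrite !natrM !ler_wpM2l.
Qed.

Lemma reduction_sound (alpha eps ep : R) (K : nat) : alpha < 1 -> 0 < ep ->
  ep <= 1 / 2 ->
  (2 * z)%:R / Q%:R <= ep -> (0 < K)%N -> z%:R / K%:R <= ep ->
  2 * ep * (1 + ((z - y).+1%:R - alpha)) <= eps * (z - y)%:R ->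
  ln 2 / ep <= ln #|E|%:R ->
  (z.+1 * 2 ^ (z * K))%:R * (k%:R * n%:R ^+ (z - y - 1)) <= ep * #|E|%:R ->
  johnson_sound alpha y E k ->
  kmeans_sound (1 + (1 - alpha) / (z - y)%:R - eps) rho P k.
Proof.
move=> a1 ep0 ep1 Qe K0 Ke eA lnE Pe sE c sigma.
case: iE => k0 E0 _.
have := edge_points_sound y_gt0 yz E0 cE (card_code_set Q z_gt0 lE cE E_gt1)
  (card_code_setI Q z_gt0 lE cE E_gt1) (log_rows_gt0 z lE E_gt1) Qz K0 sE c
    sigma.
apply: le_trans; rewrite cardP (size_log_rows z lE E_gt1) (natrM _ C).
have [_ t2] := @trunc_log_ln R #|E| (ltnW E_gt1).
have l20 := @ln2_gt0 R.
have s0 : 0 < (z - y)%:R :> R by rewrite ltr0n subn_gt0.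
apply: le_trans (gap_arith (t := ln #|E|%:R / ln 2) ep0 ep1 _ eA _ _ _ _ t2 Ke
  Pe) => //.
- suff -> : (1 + (1 - alpha) / (z - y)%:R - eps) * (rho * (#|E|%:R * ln
  #|E|%:R)) =
      ((z - y).+1%:R - alpha - eps * (z - y)%:R) *
      (C%:R * (ln #|E|%:R / ln 2 * #|E|%:R)) by [].
  rewrite -natr1 /rho; field; rewrite !gt_eqF //.
- have : 1 <= (z - y)%:R :> R by rewrite ler1n subn_gt0.
  by rewrite -natr1; move: a1; lra.
- by rewrite lerBlDr; lra.
- by rewrite mulrA ler_pdivlMr // mul1r mulrC -ler_pdivrMr.
Qed.

End ReductionCorrect.

Lemma exists_inv_le (R : realType) (x e : R) : 0 <= x -> 0 < e ->
  exists2 N : nat, (0 < N)%N & forall N', (N <= N')%N -> x / N'%:R <= e.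
Proof.
move=> x0 e0; exists (Num.bound (x / e)).+1 => // N' NN.
have N0 : 0 < N'%:R :> R by rewrite ltr0n; exact: leq_ltn_trans NN.
rewrite ler_pdivrMr // mulrC -ler_pdivrMr // ltW //.
apply: lt_le_trans (archi_boundP _) _; first by rewrite divr_ge0 // ltW.
by rewrite ler_nat ltnW.
Qed.

(** As k n^(z-y-1) is at least 1, the rate also bounds [#|E|] itself from below, which makes the
    rounding of the logarithm negligible. *)
Lemma rate_eventually (R : realType) (h : nat -> R) (z y : nat) (B : R) :
  (h m @[m --> \oo] --> +oo)%classic ->
  exists n0, forall n (E : {set {set 'I_n}}) k, (n0 <= n)%N ->
    johnson_star_instance h z y E k ->
    B <= #|E|%:R /\ B * (k%:R * n%:R ^+ (z - y - 1)) <= #|E|%:R :> R.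
Proof.
move=> /cvgryPge /(_ (Num.max B 0)) [n0 _ n0P];
  exists n0.+1 => n E k nn [[k0 E0 _] hE].
have hn : Num.max B 0 <= h n by apply: n0P; exact: ltnW.
have [hB h0] : B <= h n /\ 0 <= h n by move: hn; rewrite ge_max => /andP.
(* The threshold [n0.+1] was taken to make [n] positive here. *)
have f1 : 1 <= k%:R * n%:R ^+ (z - y - 1) :> R.
  by rewrite -natrX -natrM ler1n muln_gt0 k0 expn_gt0 (leq_ltn_trans _ nn).
have f0 : 0 <= k%:R * n%:R ^+ (z - y - 1) :> R by apply: le_trans f1.
split; apply: le_trans hE; last by rewrite ler_wpM2r.
by apply: le_trans hB _; rewrite ler_peMr.
Qed.

Theorem theorem3p16 (R : realType) (z y : nat) (alpha : R)
    (hy : (1 <= y)%N) (hyz : (y < z)%N)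
    (halpha0 : 0 <= alpha) (halpha1 : alpha < 1)
    (hJC : johnson_coverage_star_NP_hard alpha z y) :
  forall eps : R, 0 < eps ->
    exists rho D : R, 0 < rho /\
      NP_hard (gap_kmeans D rho (1 + (1 - alpha) / (z - y)%:R - eps)).
Proof.
move=> eps eps0; case: hJC => h [hoo hard].
have s0 : 0 < (z - y)%:R :> R by rewrite ltr0n subn_gt0.
have l20 := @ln2_gt0 R.
set A : R := (z - y).+1%:R - alpha.
have A0 : 0 < 1 + A by rewrite /A -natr1; lra.
(* The second bound is the hypothesis of [gap_arith] with [e = eps * (z - y)]; the factor z - y
   appears because the gap is measured relative to the complete cost. *)
pose ep := Num.min (1 / 2) (eps * (z - y)%:R / (2 * (1 + A))).
have ep0 : 0 < ep by rewrite lt_min divr_gt0 // divr_gt0 ?mulr_gt0.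
have ep1 : ep <= 1 / 2 by rewrite ge_min lexx.
have epA : 2 * ep * (1 + A) <= eps * (z - y)%:R.
  have : ep <= eps * (z - y)%:R / (2 * (1 + A)) by rewrite ge_min lexx orbT.
  by rewrite ler_pdivlMr ?mulr_gt0 // mulrCA mulrA.
have [Q1 _ Q1P] := exists_inv_le (ler0n R (2 * z)) ep0.
have [K K0 KP] := exists_inv_le (ler0n R z) ep0.
(* Large enough for the relative loss 2 z / Q to be at most [ep], and above 2 z, which keeps the
   points distinct. *)
pose Q := (Q1 + 2 * z).+1.
have Qz : (2 * z < Q)%N by rewrite ltnS leq_addl.
have Qep : (2 * z)%:R / Q%:R <= ep by apply: Q1P; rewrite ltnW // ltnS leq_addr.
have {}KP := KP K (leqnn K).
pose q := (8 ^ Q)%N; pose C := z.+2.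
pose rho : R := (z - y)%:R * C%:R / ln 2.
have rho0 : 0 < rho by rewrite divr_gt0 // mulr_gt0.
pose gap : R := 1 + (1 - alpha) / (z - y)%:R - eps.
(* Large enough for one centre on the two fixed vectors to reach the soundness threshold. *)
pose d := (Num.bound (gap * (rho * (2 * ln 2)) * 2)).+1.
have dP : gap * (rho * (2 * ln 2)) <= d%:R / 2.
  rewrite ler_pdivlMr // ltW //; apply: lt_le_trans (unstable.ltr_bound _) _.
  by rewrite ler_nat leqnSn.
(* Covers the dimension of the reduction as well as [d], whose instances have only two points. *)
pose D : R := (q * C + d)%:R / ln 2.
have D1 : (q * C)%:R / ln 2 <= D by rewrite ler_pM2r ?invr_gt0 // ler_nat
  leq_addr.
have D2 : d%:R <= D * ln 2 by rewrite divfK ?gt_eqF // ler_nat leq_addl.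
exists rho, D; split=> // L /hard[f [f_poly fP]].
pose rows2 : seq bitseq := [seq tval a | a <- enum (two_points d)].
pose yes : bitseq * seq bitseq := (nseq 2 true, rows2).
pose no : bitseq * seq bitseq := (nseq 1 true, rows2).
have inst2 k : (0 < k)%N -> kmeans_instance D (two_points d) k.
  by move=> k0; split=> //; rewrite card_two_points.
have yesP : yes_instance (gap_kmeans D rho gap) (enc yes).
  exists d, (two_points d), 2; split; [exact: encodes_two_points|exact: inst2|].
  by apply: two_points_complete => //; exact: ltW.
have noP : no_instance (gap_kmeans D rho gap) (enc no).
  exists d, (two_points d), 1; split; [exact: encodes_two_points|exact: inst2|].
  exact: two_points_sound.
pose Err : R := (z.+1 * 2 ^ (z * K))%:R.
(* The first bound absorbs the bad edges; the exponential makes ln |E| at least ln 2 / ep, and the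
   summand 2 ensures more than one edge. *)
pose B := Num.max (Err / ep) (expR (ln 2 / ep) + 2).
have [n0 n0P] := rate_eventually z y B hoo.
(* On universes of size below [n0] the rate [h] says nothing; negative instances
   there have bounded encodings, so finitely many answers are hard-coded. *)
pose W := words_upto (2 ^ n0 * (2 * n0 + 4)).
pose out (w : bitseq) := if `[< exists x, L x /\ f x = w >] then yes else no.
(* Every image of [f] is the encoding of a pair, so [F] is computed by the program of [f], without
   decoding. *)
have fE x : exists p : bitseq * seq bitseq, enc p = f x.
  have [Lx|Lx] := pselect (L x).
    have [n [E [k [[l [_ ->]] _ _]]]] := (fP x).1 Lx.
    by exists (nseq k true, [seq char_vector T | T <- l]).
  have [n [E [k [[l [_ ->]] _ _]]]] := (fP x).2 Lx.
  by exists (nseq k true, [seq char_vector T | T <- l]).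
have [F FP] := choice fE.
pose (r := fun p : bitseq * seq bitseq =>
  if enc p \in W then out (enc p) else reduction q C Q yes p).
exists (fun x => enc (r (F x))); split.
  apply: poly_time_of_polytime.
  have PF : polytime F by apply: (polytime_enc (i :=
    id) (polytime_of_poly_time f_poly)).
  have Pr : polytime r by apply: polytime_table; exact: polytime_reduction.
  by apply: (polytime_enc (i := id) (polytime_comp PF Pr)).
have FE x k rows : f x = encode k rows -> F x = (nseq k true, rows).
  by move=> fx; apply: enc_pair_inj; rewrite FP fx.
move=> x; split=> Lx; rewrite /r FP.
- case: ifP => _.
    by rewrite /out asboolT //; exists x.
  have [n [E [k [[l [lE fx]] [iE _] cE]]]] := (fP x).1 Lx.
  rewrite (FE _ _ _ fx); have [E1|E1] := leqP #|E| 1.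
    by rewrite (reduction_trivial _ _ lE iE E1).
  exists _, (edge_points E (code_set z Q l)), k; split.
  + exact: (reduction_encodes yes hyz Qz lE iE E1).
  + exact: (reduction_instance hyz Qz D1 lE iE E1).
  + exact: (reduction_complete R hyz Qz lE iE E1 cE).
- have noI := (fP x).2 Lx; case: ifP => [_|].
    (* An [x'] in [L] with the same image would make one word both a positive and a negative
       instance. *)
    rewrite /out asboolF // => -[x' [Lx' fx']].
    have := (fP x').1 Lx'; rewrite fx' => /(yes_not_no halpha1); exact.
  rewrite mem_words_upto => /negP/negP; rewrite -ltnNge => wN.
  have [n [E [k [[l [lE fx]] sI sE]]]] := noI.
  have iE := sI.1.
  (* A negative instance outside the table has a large universe, so the rate applies. *)
  have nn : (n0 <= n)%N.
    rewrite leqNgt; apply/negP => nn; move: wN; rewrite ltnNge.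
    rewrite (no_instance_size halpha1 hyz _ iE sE nn) //.
    by exists l.
  have [Bm Bk] := n0P n E k nn sI.
  have [m1 m2] : Err / ep <= #|E|%:R /\ expR (ln 2 / ep) + 2 <= #|E|%:R.
    by move: Bm; rewrite /B ge_max => /andP.
  have ex0 := expR_gt0 (ln 2 / ep).
  have E1 : (1 < #|E|)%N.
    by rewrite -(ltr_nat R); apply: lt_le_trans m2; lra.
  rewrite (FE _ _ _ fx).
  exists _, (edge_points E (code_set z Q l)), k; split.
  + exact: (reduction_encodes yes hyz Qz lE iE E1).
  + exact: (reduction_instance hyz Qz D1 lE iE E1).
  + apply: (reduction_sound hy hyz Qz lE iE E1 halpha1 ep0 ep1 Qep K0 KP epA) =>
    //.
      rewrite -(ler_expR) lnK ?posrE ?ltr0n ?(ltnW E1) //.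
      by apply: le_trans m2; lra.
    rewrite -ler_pdivrMl //; apply: le_trans Bk; rewrite [leLHS]mulrA.
    apply: ler_wpM2r; first by rewrite mulr_ge0 // exprn_ge0.
    by rewrite mulrC /B le_max lexx.
Qed.
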